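(* Let $F$ be a field and let $\Gamma=(V,E)$ be a finite uniform layered graph without multiple edges, with $V=\coprod_{i=0}^3 V_i$, with exactly one minimal vertex, and with all minimal vertices contained in $V_0$. Suppose $V_3=\{a\}$ and $a>b$ for every $b\in V_2$. Then $A(\Gamma)$ and $B(\Gamma)$ are Koszul and $$h(B(\Gamma),\tau)=1+|V_+|\,\tau+(|E_2|-1)\,\tau^2+(|E_2|-|V_1|-|V_2|+1)\,\tau^3.$$
   Context: Layered graphs: $\Gamma=(V,E)$ is a directed graph; for $e\in E$, $t(e)$ is its tail and $h(e)$ its head (the edge goes from $t(e)$ to $h(e)$). $\Gamma$ is layered if $V=\coprod_{i=0}^N V_i$ and, writing $|v|=i$ (the level of $v$) for $v\in V_i$, one has $|t(e)|=|h(e)|+1$ for every $e\in E$. $V$ is regarded as a poset: $u>v$ iff there is a directed path (with at least one edge) from $u$ to $v$. $E_i$ denotes the set of edges with tail in $V_i$, and $V_+=\coprod_{i>0}V_i$. Uniform: vertices $v,v'$ of the same level $i>0$ are connected by a down-up sequence if there are $v=v_0,v_1,\dots,v_k=v'$ in $V_i$ and $w_1,\dots,w_k\in V_{i-1}$ with $w_j<v_{j-1}$ and $w_j<v_j$ for $j=1,\dots,k$ (a vertex is connected to itself by the sequence with $k=0$). $\Gamma$ is uniform if for any two edges $e,e'$ with $t(e)=t(e')$, the heads $h(e),h(e')$ are connected by a down-up sequence $v_0,\dots,v_k$ with $v_j<t(e)$ for all $j$. The algebra $A(\Gamma)$: the associative unital $F$-algebra generated by the edges $e\in E$, subject to the following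 relations: for any two directed paths $(e_1,\dots,e_k)$ and $(f_1,\dots,f_k)$ having the same tail $t(e_1)=t(f_1)$ and the same head $h(e_k)=h(f_k)$, all coefficients in the central variable $t$ of $(t-e_1)\cdots(t-e_k)=(t-f_1)\cdots(t-f_k)$ agree. It is graded with each edge in degree 1. The algebra $B(\Gamma)$: for $v\in V_+$ let $S(v)$ be the set of vertices $w$ such that there is an edge from $v$ to $w$. $B(\Gamma)$ is the associative unital $F$-algebra generated by the vertices $v\in V_+$ with relations (i) $u\cdot v=0$ for $u,v\in V_+$ if there is no edge from $u$ to $v$; (ii) $v\cdot\sum_{w\in S(v)}w=0$ for every $v$ with $|v|>1$. It is graded with each generator in degree 1, and $h(B,\tau)=\sum_n\dim(B_n)\tau^n$. Koszul is the standard notion for quadratic graded algebras.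
   Formalization: The Hilbert series formula is proved under the added condition that every vertex of V_1 lies below some vertex of V_2; without it the printed τ³ coefficient is wrong (edges a→b, b→c, c→*, c'→* give −1). Koszulity of A(Γ) and B(Γ) needs no added condition. *)

(* Defs.v *)
From HB Require Import structures.
From mathcomp Require Import all_boot all_order all_algebra.
From mathcomp Require Import boolp.
From mathcomp Require Import monalg.

Set Implicit Arguments.
Unset Strict Implicit.
Unset Printing Implicit Defensive.

Import GRing.Theory.
Local Open Scope ring_scope.
Local Open Scope quotient_scope.

(** * Quotient of an algebra by a two-sided ideal *)

Section QuotientAlgebra.
Variables (F : fieldType) (T : algType F) (rel : T -> Prop).

Definition in_relideal (x : T) : Prop :=
  exists (n : nat) (u r v : 'I_n -> T),
    (forall i, rel (r i)) /\ x = \sum_(i < n) u i * r i * v i.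

Definition relideal : {pred T} := fun x => `[< in_relideal x >].

Lemma relidealP x : reflect (in_relideal x) (x \in relideal).
Proof. exact: asboolP. Qed.

Fact relideal_zmod_closed : zmod_closed relideal.
Proof.
split=> [|x y].
  apply/relidealP; exists 0%N, (fun=> 0), (fun=> 0), (fun=> 0).
  by split=> [[]//|]; rewrite big_ord0.
move=> /relidealP[m [u [r [v [hr ->]]]]] /relidealP[n [u' [r' [v' [hr' ->]]]]].
apply/relidealP; exists (m + n)%N.
exists (fun i => match split i with inl j => u j | inr j => - u' j end).
exists (fun i => match split i with inl j => r j | inr j => r' j end).
exists (fun i => match split i with inl j => v j | inr j => v' j end).
split=> [i|]; first by case: (split i).
rewrite [RHS]big_split_ord /=; congr (_ + _).
  by apply: eq_bigr => i _; rewrite (unsplitK (inl i)).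
rewrite -sumrN; apply: eq_bigr => i _.
by rewrite (unsplitK (inr i)) !mulNr.
Qed.

HB.instance Definition _ := GRing.isZmodClosed.Build T relideal
  relideal_zmod_closed.

Fact relidealMl a x : x \in relideal -> a * x \in relideal.
Proof.
move=> /relidealP[n [u [r [v [hr ->]]]]]; apply/relidealP.
exists n, (fun i => a * u i), r, v; split=> //.
by rewrite mulr_sumr; apply: eq_bigr => i _; rewrite !mulrA.
Qed.

Fact relidealMr a x : x \in relideal -> x * a \in relideal.
Proof.
move=> /relidealP[n [u [r [v [hr ->]]]]]; apply/relidealP.
exists n, u, r, (fun i => v i * a); split=> //.
by rewrite mulr_suml; apply: eq_bigr => i _; rewrite !mulrA.
Qed.

Fact relidealZ (c : F) x : x \in relideal -> c *: x \in relideal.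
Proof. by rewrite -[x in c *: x]mul1r scalerAl; apply: relidealMl. Qed.

(* [algType] requires 1 != 0, hence the properness hypothesis. *)
Hypothesis proper : 1 \notin relideal.

Definition quot_alg (_ : 1 \notin relideal) := Quotient.quot relideal.
Local Notation Q := (quot_alg proper).
HB.instance Definition _ := GRing.Zmodule.on Q.
HB.instance Definition _ := EqQuotient.on Q.

Definition qpi (x : T) : Q := \pi x.

Lemma qpi_eq x y : (qpi x = qpi y) <-> (x - y \in relideal).
Proof. by rewrite (Quotient.idealrBE relideal); split => [/eqP|/eqP]. Qed.

Lemma qpi_repr (x : Q) : qpi (repr x) = x.
Proof. exact: reprK. Qed.

Lemma qpi_surj (x : Q) : exists y, x = qpi y.
Proof. by exists (repr x); rewrite qpi_repr. Qed.

Definition quot_one : Q := qpi 1.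
Definition quot_mul (x y : Q) : Q := qpi (repr x * repr y).
Definition quot_scale (c : F) (x : Q) : Q := qpi (c *: repr x).

Fact qpi_mul x y : quot_mul (qpi x) (qpi y) = qpi (x * y).
Proof.
apply/qpi_eq.
have hx : repr (qpi x) - x \in relideal by apply/qpi_eq; rewrite qpi_repr.
have hy : repr (qpi y) - y \in relideal by apply/qpi_eq; rewrite qpi_repr.
have -> : repr (qpi x) * repr (qpi y) - x * y =
    (repr (qpi x) - x) * repr (qpi y) + x * (repr (qpi y) - y).
  by rewrite mulrBl mulrBr addrA subrK.
by apply: rpredD; [apply: relidealMr | apply: relidealMl].
Qed.

Fact qpi_scale c x : quot_scale c (qpi x) = qpi (c *: x).
Proof.
apply/qpi_eq; rewrite -scalerBr; apply: relidealZ; apply/qpi_eq.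
by rewrite qpi_repr.
Qed.

Fact qpiD x y : qpi (x + y) = qpi x + qpi y.
Proof. by rewrite /qpi piE. Qed.

Fact quot_mulA : associative quot_mul.
Proof.
move=> x y z; have [a ->] := qpi_surj x; have [b ->] := qpi_surj y.
by have [c ->] := qpi_surj z; rewrite !qpi_mul mulrA.
Qed.
Fact quot_mul1 : left_id quot_one quot_mul.
Proof. by move=> x; have [a ->] := qpi_surj x; rewrite qpi_mul mul1r. Qed.
Fact quot_mulr1 : right_id quot_one quot_mul.
Proof. by move=> x; have [a ->] := qpi_surj x; rewrite qpi_mul mulr1. Qed.
Fact quot_mulDl : left_distributive quot_mul +%R.
Proof.
move=> x y z; have [a ->] := qpi_surj x; have [b ->] := qpi_surj y.
by have [c ->] := qpi_surj z; rewrite -qpiD !qpi_mul mulrDl qpiD.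
Qed.
Fact quot_mulDr : right_distributive quot_mul +%R.
Proof.
move=> x y z; have [a ->] := qpi_surj x; have [b ->] := qpi_surj y.
by have [c ->] := qpi_surj z; rewrite -qpiD !qpi_mul mulrDr qpiD.
Qed.
Fact quot_one_neq0 : quot_one != 0.
Proof.
apply/eqP; have -> : (0 : Q) = qpi 0 by rewrite /qpi piE.
by move=> /qpi_eq; rewrite subr0; apply/negP.
Qed.

HB.instance Definition _ := GRing.Zmodule_isNzRing.Build Q
  quot_mulA quot_mul1 quot_mulr1 quot_mulDl quot_mulDr quot_one_neq0.

Fact quot_scaleA a b x : quot_scale a (quot_scale b x) = quot_scale (a * b) x.
Proof. by have [y ->] := qpi_surj x; rewrite !qpi_scale scalerA. Qed.
Fact quot_scale1 : left_id 1 quot_scale.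
Proof. by move=> x; have [y ->] := qpi_surj x; rewrite qpi_scale scale1r. Qed.
Fact quot_scaleDr : right_distributive quot_scale +%R.
Proof.
move=> c x y; have [a ->] := qpi_surj x; have [b ->] := qpi_surj y.
by rewrite -qpiD !qpi_scale scalerDr qpiD.
Qed.
Fact quot_scaleDl x : {morph quot_scale^~ x : a b / a + b}.
Proof.
by move=> a b; have [y ->] := qpi_surj x; rewrite !qpi_scale scalerDl qpiD.
Qed.

HB.instance Definition _ := GRing.Zmodule_isLmodule.Build F Q
  quot_scaleA quot_scale1 quot_scaleDr quot_scaleDl.

Fact quot_scaleAl (c : F) (x y : Q) : c *: (x * y) = (c *: x) * y.
Proof.
have [a ->] := qpi_surj x; have [b ->] := qpi_surj y.
change (quot_scale c (quot_mul (qpi a) (qpi b)) =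
        quot_mul (quot_scale c (qpi a)) (qpi b)).
by rewrite qpi_mul !qpi_scale qpi_mul scalerAl.
Qed.

HB.instance Definition _ := GRing.Lmodule_isLalgebra.Build F Q
  quot_scaleAl.

Fact quot_scaleAr (c : F) (x y : Q) : c *: (x * y) = x * (c *: y).
Proof.
have [a ->] := qpi_surj x; have [b ->] := qpi_surj y.
change (quot_scale c (quot_mul (qpi a) (qpi b)) =
        quot_mul (qpi a) (quot_scale c (qpi b))).
by rewrite qpi_mul !qpi_scale qpi_mul scalerAr.
Qed.

HB.instance Definition _ := GRing.Lalgebra_isAlgebra.Build F Q
  quot_scaleAr.

End QuotientAlgebra.

(** * Presented algebras *)

Definition freeAlg (F : fieldType) (X : finType) := {malg F[{fmonom X}]}.

Section FreeAlgebra.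
Variables (F : fieldType) (X : finType).
Local Notation T := (freeAlg F X).

HB.instance Definition _ := GRing.Lalgebra.on T.

Fact free_scaleAr (c : F) (x y : T) : c *: (x * y) = x * (c *: y).
Proof.
have commC : << c *g mone >> * x = x * << c *g mone >> :> {malg F[{fmonom X}]}.
  rewrite [LHS]fgmulUg [RHS]fgmulgU; apply: eq_bigr => k _.
  by rewrite mul1m mulm1 mulrC.
by rewrite -!mul_malgC mulrA [_ * x]commC mulrA.
Qed.

HB.instance Definition _ := GRing.Lalgebra_isAlgebra.Build F T free_scaleAr.

Definition fgen (x : X) : T := << fmu x >>.

End FreeAlgebra.

(* Relations without constant term always generate a proper ideal. *)
Record relations (F : fieldType) (X : finType) := Relations {
  is_rel :> freeAlg F X -> Prop;
  is_rel_aug : forall r, is_rel r -> mcoeff mone r = 0 }.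

Section PresentedAlgebra.
Variables (F : fieldType) (X : finType) (rel : relations F X).

Fact relations_proper : 1 \notin relideal rel.
Proof.
apply/negP => /relidealP[n [u [r [v [hr /(congr1 (mcoeff mone))]]]]].
rewrite mcoeff1 eqxx raddf_sum big1 => [/eqP|i _]; first by rewrite oner_eq0.
by rewrite /= !rmorphM /= (is_rel_aug (hr i)) mulr0 mul0r.
Qed.

Definition presAlg : algType F := quot_alg relations_proper.

Definition pgen (x : X) : presAlg := qpi relations_proper (fgen F x).

Definition hcomp (n : nat) (y : presAlg) : Prop :=
  exists c : n.-tuple X -> F,
    y = \sum_(w : n.-tuple X) c w *: \prod_(x <- w) pgen x.

End PresentedAlgebra.

(** * Koszul algebras and Hilbert series *)

Section GradedAlgebra.
Variables (F : fieldType) (A : algType F) (gr : nat -> A -> Prop).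

Definition augmentation_ideal (x : A) : Prop :=
  exists (n : nat) (y : 'I_n -> A),
    (forall i : 'I_n, gr i.+1 (y i)) /\ x = \sum_(i < n) y i.

(* The trivial module F = A / A_+ has a linear graded free resolution
     ... -> P_2 -> P_1 -> P_0 = A -> F -> 0
   by left A-modules, P_i = A(-i)^(r i) being generated in degree i.  Elements
   of P_i are row vectors, and a degree preserving map P_(i+1) -> P_i is right
   multiplication by a matrix with entries in A_1.  All algebras considered here
   are connected and finitely generated, so graded projectives of the resolution
   are free, and those of a linear resolution have finite rank.  Existence of
   such a resolution forces A to be quadratic. *)
Definition koszul : Prop :=
  exists (r : nat -> nat) (d : forall i, 'M[A]_(r i.+1, r i)),
    [/\ r 0%N = 1%N,
        forall i j k, gr 1%N (d i j k),
        forall x : 'rV[A]_(r 0%N),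
          (forall j, augmentation_ideal (x 0 j)) <-> exists y, x = y *m d 0%N
      & forall i (x : 'rV[A]_(r i.+1)),
          x *m d i = 0 <-> exists y, x = y *m d i.+1].

Definition has_dim (U : A -> Prop) (n : nat) : Prop :=
  exists b : 'I_n -> A,
    (forall x, U x <-> exists c : 'I_n -> F, x = \sum_i c i *: b i)
    /\ (forall c : 'I_n -> F, \sum_i c i *: b i = 0 -> forall i, c i = 0).

Definition hilbert_series_eq (h : {poly int}) : Prop :=
  forall n, exists2 k : nat, has_dim (gr n) k & k%:Z = h`_n.

End GradedAlgebra.

(** * Layered graphs *)

Record layeredGraph := LayeredGraph {
  vertex : finType;
  edge : finType;
  etail : edge -> vertex;
  ehead : edge -> vertex;
  level : vertex -> nat;
  level_etail : forall e, level (etail e) = (level (ehead e)).+1 }.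

Section Graph.
Variable G : layeredGraph.
Local Notation V := (vertex G).
Local Notation E := (edge G).

Definition layer (i : nat) : {set V} := [set v | level v == i].
Definition edges_from (i : nat) : {set E} := [set e | etail e \in layer i].

Definition adj (u v : V) : bool :=
  [exists e : E, (etail e == u) && (ehead e == v)].

Definition above (u v : V) : bool := [exists w, adj u w && connect adj w v].

Definition minimal (v : V) : Prop := forall u, ~~ above v u.

Definition simple_edges : Prop :=
  forall e f : E, etail e = etail f -> ehead e = ehead f -> e = f.

(* One step of a down-up sequence; the condition on the level of [w] forces the
   common level of [u] and [v] to be positive. *)
Definition down_up (u v : V) : bool :=
  (level u == level v) &&
  [exists w, [&& (level w).+1 == level u, above u w & above v w]].

Definition uniform : Prop :=
  forall e e' : E, etail e = etail e' ->
    exists s : seq V,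
      [/\ path down_up (ehead e) s, last (ehead e) s = ehead e'
        & all (above (etail e)) (ehead e :: s)].

(* [e :: p] is a directed path *)
Definition dipath (e : E) (p : seq E) : bool :=
  path (fun f g => ehead f == etail g) e p.

Definition posVertex := {v : V | (0 < level v)%N}.

Section Algebras.
Variable F : fieldType.

(* (t - e_1) ... (t - e_k), with 'X in the role of the central variable t *)
Definition path_poly (p : seq E) : {poly freeAlg F E} :=
  \prod_(e <- p) ('X - (fgen F e)%:P).

Definition A_is_rel (r : freeAlg F E) : Prop :=
  exists (e f : E) (p q : seq E) (i : nat),
    [/\ dipath e p, dipath f q, size p = size q, etail e = etail f
      & ehead (last e p) = ehead (last f q)]
    /\ r = (path_poly (e :: p))`_i - (path_poly (f :: q))`_i.

Lemma path_poly_aug p : map_poly (mcoeff mone) (path_poly p) = 'X^(size p).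
Proof.
elim: p => [|e p IHp]; first by rewrite /path_poly big_nil rmorph1.
rewrite /path_poly big_cons rmorphM /= [X in _ * X]IHp exprS; congr (_ * _).
rewrite rmorphB /= map_polyX map_polyC /= mcoeffU.
suff /negPf-> : fmu e != mone by rewrite mulr0n subr0.
by apply/eqP => /(congr1 (@fdeg _)); rewrite fdegU fdeg1.
Qed.

Fact A_is_rel_aug r : A_is_rel r -> r@_mone = 0.
Proof.
case=> e [f [p [q [i [[_ _ spq _ _] ->]]]]].
have aug s : mcoeff mone (path_poly s)`_i = ('X^(size s) : {poly F})`_i.
  by rewrite -path_poly_aug coef_map.
by rewrite mcoeffB !aug /= spq subrr.
Qed.

Definition A_relations := Relations A_is_rel_aug.

Definition B_is_rel (r : freeAlg F posVertex) : Prop :=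
  (exists u v : posVertex,
      ~~ adj (val u) (val v) /\ r = fgen F u * fgen F v)
  \/ (exists v : posVertex, (1 < level (val v))%N /\
      r = fgen F v * \sum_(w : posVertex | adj (val v) (val w)) fgen F w).

Fact B_is_rel_aug r : B_is_rel r -> r@_mone = 0.
Proof.
have fgen1 (v : posVertex) : (fgen F v)@_mone = 0.
  rewrite mcoeffU.
  suff /negPf-> : fmu v != mone by [].
  by apply/eqP => /(congr1 (@fdeg _)); rewrite fdegU fdeg1.
by case=> [[u [v [_ ->]]]|[v [_ ->]]]; rewrite rmorphM /= fgen1 mul0r.
Qed.

Definition B_relations := Relations B_is_rel_aug.

Definition algA : algType F := presAlg A_relations.
Definition algB : algType F := presAlg B_relations.

Definition grA : nat -> algA -> Prop := hcomp (rel := A_relations).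
Definition grB : nat -> algB -> Prop := hcomp (rel := B_relations).

End Algebras.
End Graph.

(* Main.v *)
From HB Require Import structures.
Require Import Defs.
From mathcomp Require Import all_boot all_order all_algebra.
From mathcomp Require Import boolp monalg zify.

Set Implicit Arguments.
Unset Strict Implicit.
Unset Printing Implicit Defensive.

Import GRing.Theory.
Local Open Scope ring_scope.

(** Left syzygies between the generators of a presented algebra can be read off
    from the last letters of its relations ([pres_syzygy]); this makes both Koszul
    statements elementary.

    A(Gamma) is generated by the vertices of positive level, subject to the
    relations saying that the coefficient (a - b) b + (b - c) c of P_a(t) does not
    depend on the path a -> b -> c: the cubic relations follow by connectivity of
    the second layer and cancellation of monic polynomials.  No relation ends in
    the letter a, so right multiplication by a - b is injective.  These two facts
    yield exactness of the linear complex
      0 -> A (x) Z -> A^(|E_2| - 1) -> A^(V_+) -> A,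
    where Z is the space of functions on E_2 with zero sum at every vertex.

    Over B(Gamma), the class of matrices [good] below is closed under taking
    syzygies, because a combination of the a b c with coefficients m_bc vanishes
    if and only if m_bc = p_b + q_c; iterating gives the linear resolution.  The
    same description shows that B_3 is the space of functions on E_2 modulo those
    of the form p_b + q_c, which by connectivity have dimension
    |V_1| + |V_2| - 1. *)

(** * Free and presented algebras *)

(** The two resolutions are of different kinds, and neither Koszul property is deduced from the
    other. Over [A] the complex stops after three steps, so its matrices can be written down and
    exactness checked place by place; but no basis of [A] is at hand, and every cancellation has to
    be extracted from the shape of the relations. Over [B] the multiplication is under control,
    since words of length four vanish, but the resolution need not stop and its matrices have no
    closed form; hence an invariant that passes from one matrix to the next. In [A] the edges give
    way to vertices because all products over paths from [v] down to level zero share one value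
    P_v(t), of degree [|v|]; uniqueness of the minimal vertex makes these products comparable. Up to
    sign, the vertex element is the subleading coefficient of P_v(t), and an edge is the difference
    of the elements of its tail and its head. *)

Section FreeAlgebra.
Variables (F : fieldType) (X : finType).
Local Notation T := (freeAlg F X).

Lemma fgen_word (w : {fmonom X}) : << w >> = \prod_(x <- w) fgen F x :> T.
Proof.
case: w => w /=; elim: w => [|x w IHw].
  by rewrite big_nil; congr << _ >>; rewrite /mone /= fmoneE.
rewrite big_cons -IHw /fgen [RHS](fgmulUU (K := {fmonom X})) mulr1.
by congr << _ >>; apply/eqP; rewrite fmP fmM fmU.
Qed.

Lemma freeAlg_ind (P : T -> Prop) :
    P 1 -> (forall x y, P x -> P y -> P (x + y)) ->
    (forall c x, P x -> P (c *: x)) ->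
    (forall v x, P x -> P (fgen F v * x)) ->
  forall x, P x.
Proof.
move=> P1 PD PZ PM x.
have P0 : P 0 by rewrite -(scale0r 1); apply: PZ.
rewrite (monalgE x); apply: (big_ind P) => // w _.
have -> : << x@_w *g w >> = x@_w *: << w >> :> T.
  apply/malgP => k; rewrite mcoeffZ !mcoeffU.
  by case: eqP; rewrite ?mulr1 ?mulr0.
apply: PZ; rewrite fgen_word; elim: (w : seq X) => [|v s IHs].
  by rewrite big_nil.
by rewrite big_cons; apply: PM.
Qed.

Section Hom.
Variables (S : nzRingType) (f : {rmorphism F -> S}) (h : X -> S).
Hypothesis f_central : forall c x, f c * x = x * f c.

Let hw (w : {fmonom X}) : S := \prod_(x <- w) h x.

Fact hw_mmorphism : mmorphism hw.
Proof.
split=> [w w'|]; first by rewrite /hw fmM big_cat.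
by rewrite /hw fm1 big_nil.
Qed.
HB.instance Definition _ := isMultiplicative.Build _ S hw hw_mmorphism.

Let phi : T -> S := mmap f hw.
Fact phi_zmod : zmod_morphism phi.
Proof. exact: mmap_is_additive. Qed.
Fact phi_monoid : monoid_morphism phi.
Proof.
have [MM M1] := @commr_mmap_is_multiplicative {fmonom X} F S f hw
  (fun g m m' => f_central _ _).
by split.
Qed.
HB.instance Definition _ := GRing.isZmodMorphism.Build T S phi phi_zmod.
HB.instance Definition _ := GRing.isMonoidMorphism.Build T S phi phi_monoid.

(** The target is only a ring with a central map [f] from [F], so that the 2 by 2 matrices over an
    algebra qualify, with [F] acting through scalar matrices. *)
Lemma freeAlg_hom : exists phi : {rmorphism T -> S},
  (forall x, phi (fgen F x) = h x) /\ (forall c x, phi (c *: x) = f c * phi x).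
Proof.
exists phi; split=> [x|c x] /=; last exact: mmapZ.
by rewrite /phi mmapU /= rmorph1 mul1r /hw fmU big_seq1.
Qed.

End Hom.
End FreeAlgebra.

Section PresentedAlgebra.
Variables (F : fieldType) (X : finType) (rel : relations F X).
Local Notation T := (freeAlg F X).
Local Notation A := (presAlg rel).

Definition pres_pi : T -> A := qpi (relations_proper rel).

Fact pres_pi_zmod : zmod_morphism pres_pi.
Proof.
move=> x y; have add u v : pres_pi (u + v) = pres_pi u + pres_pi v.
  exact (qpiD (relations_proper rel) u v).
by apply/eqP; rewrite eq_sym subr_eq -add subrK.
Qed.
HB.instance Definition _ := GRing.isZmodMorphism.Build T A pres_pi pres_pi_zmod.

Fact pres_pi_monoid : monoid_morphism pres_pi.
Proof. by split=> [|x y]; [|exact (esym (qpi_mul (relations_proper rel) x y))]. Qed.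
HB.instance Definition _ := GRing.isMonoidMorphism.Build T A pres_pi
  pres_pi_monoid.

Lemma pres_piZ c x : pres_pi (c *: x) = c *: pres_pi x.
Proof. exact (esym (qpi_scale (relations_proper rel) c x)). Qed.

Lemma pres_pi_surj (x : A) : exists y, x = pres_pi y.
Proof. exact (@qpi_surj F T rel (relations_proper rel) x). Qed.

Lemma pres_pi_fgen v : pres_pi (fgen F v) = pgen rel v.
Proof. by []. Qed.

Lemma pres_pi_eq0 x : pres_pi x = 0 <-> x \in relideal rel.
Proof.
have e := qpi_eq (relations_proper rel) x 0; rewrite subr0 in e.
by rewrite -e -(rmorph0 pres_pi).
Qed.

Lemma pres_rel r : rel r -> pres_pi r = 0.
Proof.
move=> hr; apply/pres_pi_eq0/relidealP; exists 1, (fun=> 1), (fun=> r), (fun=> 1).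
by split=> //; rewrite big_ord1 mul1r mulr1.
Qed.

Lemma pres_rel_eq x y : rel (x - y) -> pres_pi x = pres_pi y.
Proof. by move=> /pres_rel; rewrite rmorphB => /subr0_eq. Qed.

Lemma presAlg_ind (P : A -> Prop) :
    P 1 -> (forall x y, P x -> P y -> P (x + y)) ->
    (forall c x, P x -> P (c *: x)) ->
    (forall v x, P x -> P (pgen rel v * x)) ->
  forall x, P x.
Proof.
move=> P1 PD PZ PM x; have [y ->] := pres_pi_surj x.
elim/freeAlg_ind: y => [|y z Py Pz|c y Py|v y Py].
- by rewrite rmorph1.
- by rewrite rmorphD; apply: PD.
- by rewrite pres_piZ; apply: PZ.
- by rewrite rmorphM; apply: PM.
Qed.

Section Factor.
Variables (S : nzRingType) (phi : {rmorphism T -> S}).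
Hypothesis phi_rel : forall r, rel r -> phi r = 0.

Lemma phi_compat x y : pres_pi x = pres_pi y -> phi x = phi y.
Proof.
move=> /eqP; rewrite -subr_eq0 -rmorphB => /eqP/pres_pi_eq0/relidealP.
case=> n [u [r [v [hr e]]]]; apply/eqP; rewrite -subr_eq0 -rmorphB e.
by rewrite rmorph_sum big1 // => i _; rewrite !rmorphM (phi_rel (hr i)) mulr0 mul0r.
Qed.

Let psi (x : A) : S := phi (repr x).
Let psiE x : psi (pres_pi x) = phi x.
Proof. by apply: phi_compat; exact (@qpi_repr F T rel (relations_proper rel) _). Qed.

Fact psi_zmod : zmod_morphism psi.
Proof.
move=> x y; have [u ->] := pres_pi_surj x; have [v ->] := pres_pi_surj y.
by rewrite -rmorphB !psiE rmorphB.
Qed.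
Fact psi_monoid : monoid_morphism psi.
Proof.
split=> [|x y]; first by rewrite -(rmorph1 pres_pi) psiE rmorph1.
have [u ->] := pres_pi_surj x; have [v ->] := pres_pi_surj y.
by rewrite -rmorphM !psiE rmorphM.
Qed.
HB.instance Definition _ := GRing.isZmodMorphism.Build A S psi psi_zmod.
HB.instance Definition _ := GRing.isMonoidMorphism.Build A S psi psi_monoid.

Lemma presAlg_factor : exists psi : {rmorphism A -> S},
  forall x, psi (pres_pi x) = phi x.
Proof. by exists psi. Qed.

End Factor.

Lemma presAlg_hom (S : nzRingType) (f : {rmorphism F -> S}) (h : X -> S) :
    (forall c x, f c * x = x * f c) ->
    (forall phi : {rmorphism T -> S}, (forall x, phi (fgen F x) = h x) ->
       forall r, rel r -> phi r = 0) ->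
  exists psi : {rmorphism A -> S},
    (forall x, psi (pgen rel x) = h x)
    /\ (forall c x, psi (c *: x) = f c * psi x).
Proof.
move=> fC hrel; have [phi [phih phiZ]] := freeAlg_hom h fC.
have [psi psiE] := presAlg_factor (hrel phi phih).
exists psi; split=> [x|c x]; first by rewrite -pres_pi_fgen psiE.
have [u ->] := pres_pi_surj x.
by rewrite -pres_piZ !psiE phiZ.
Qed.

End PresentedAlgebra.

(** * Last-letter derivatives and left syzygies *)

Section LastLetterDerivative.
Variables (F : fieldType) (X : finType) (T : algType F) (gen : X -> T).
Variable aug : T -> F.
Hypothesis T_ind : forall P : T -> Prop,
    P 1 -> (forall x y, P x -> P y -> P (x + y)) ->
    (forall c x, P x -> P (c *: x)) ->
    (forall v x, P x -> P (gen v * x)) ->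
  forall x, P x.
Hypothesis T_hom : forall (S : nzRingType) (f : {rmorphism F -> S}) (h : X -> S),
    (forall c x, f c * x = x * f c) ->
  exists phi : {rmorphism T -> S},
    (forall x, phi (gen x) = h x) /\ (forall c x, phi (c *: x) = f c * phi x).
Hypothesis aug1 : aug 1 = 1.
Hypothesis augD : forall x y, aug (x + y) = aug x + aug y.
Hypothesis augZ : forall c x, aug (c *: x) = c * aug x.
Hypothesis augM : forall x y, aug (x * y) = aug x * aug y.
Hypothesis aug_gen : forall v, aug (gen v) = 0.
Variables (A : algType F) (pi : T -> A).
Hypothesis pi1 : pi 1 = 1.
Hypothesis piD : forall x y, pi (x + y) = pi x + pi y.
Hypothesis piZ : forall c x, pi (c *: x) = c *: pi x.
Hypothesis piM : forall x y, pi (x * y) = pi x * pi y.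

(* [x] acts as the upper triangular matrix with diagonal [x, aug x]; the corner
   entry then obeys the twisted Leibniz rule. *)
Lemma fox_exists (v : X) : exists D : T -> A,
  [/\ forall x y, D (x + y) = D x + D y,
      forall c x, D (c *: x) = c *: D x,
      forall x y, D (x * y) = pi x * D y + aug  y *: D x
    & forall u, D (gen u) = (u == v)%:R].
Proof.
pose i0 : 'I_2 := ord0; pose i1 : 'I_2 := lift ord0 ord0.
pose f : {rmorphism F -> 'M[A]_2} := (@scalar_mx A 2) \o (in_alg A).
have fE c : f c = (c%:A)%:M by [].
have [|phi [phig phiZ]] := @T_hom 'M[A]_2 f
    (fun u => \matrix_(i, j) if i == i0 then
       (if j == i0 then pi (gen u) else (u == v)%:R) else 0).
  move=> c M; rewrite fE; apply/matrixP => i j; rewrite !mxE.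
  rewrite (bigD1 i) //= big1 => [|k /negPf ne]; last first.
    by rewrite mxE eq_sym ne mul0r.
  rewrite (bigD1 j) //= big1 => [|k /negPf ne]; last by rewrite mxE ne mulr0.
  by rewrite !mxE !eqxx !addr0 mulr1n -scalerAl -scalerAr mul1r mulr1.
have i10 : i1 == i0 = false by [].
have phi1 : phi 1 = 1 by rewrite rmorph1.
have H x : [/\ phi x i0 i0 = pi x, phi x i1 i0 = 0 &
               phi x i1 i1 = (aug  x)%:A].
  elim/T_ind: x => [|x y [x1 x2 x3] [y1 y2 y3]|c x [x1 x2 x3]|u x [x1 x2 x3]].
  - by rewrite phi1 !mxE aug1 scale1r pi1.
  - by rewrite rmorphD !mxE x1 x2 x3 y1 y2 y3 addr0 augD scalerDl piD.
  - have fM i j : (f c * phi x) i j = c *: phi x i j.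
      rewrite fE mxE (bigD1 i) //= big1 => [|k /negPf ne]; last first.
        by rewrite mxE eq_sym ne mul0r.
      by rewrite !mxE eqxx mulr1n addr0 -scalerAl mul1r.
    by rewrite phiZ !fM x1 x2 x3 scaler0 augZ scalerA piZ.
  - rewrite rmorphM piM phig !mxE !big_ord_recl !big_ord0 !mxE x1 x2 x3 /=.
    rewrite !(mulr0, mul0r, addr0) augM aug_gen mul0r scale0r.
    by split.
exists (fun x => phi x i0 i1); split=> [x y|c x|x y|u].
- by rewrite rmorphD mxE.
- rewrite phiZ fE mxE (bigD1 i0) //= big1 => [|k /negPf ne]; last first.
    by rewrite mxE eq_sym ne mul0r.
  by rewrite !mxE eqxx mulr1n addr0 -scalerAl mul1r.
- have [x1 _ _] := H x; have [_ _ y3] := H y.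
  rewrite rmorphM mxE !big_ord_recl big_ord0 addr0 x1 -/i0 -/i1 y3.
  by rewrite -scalerAr mulr1.
- by rewrite phig mxE.
Qed.

End LastLetterDerivative.

Section Fox.
Variables (F : fieldType) (X : finType).
Local Notation T := (freeAlg F X).

Definition free_aug (x : T) : F := mcoeff mone x.

Lemma free_augM x y : free_aug (x * y) = free_aug x * free_aug y.
Proof. by rewrite /free_aug rmorphM. Qed.
Lemma free_augD x y : free_aug (x + y) = free_aug x + free_aug y.
Proof. exact: mcoeffD. Qed.
Lemma free_augZ c x : free_aug (c *: x) = c * free_aug x.
Proof. exact: mcoeffZ. Qed.
Lemma free_aug1 : free_aug 1 = 1.
Proof. by rewrite /free_aug mcoeff1 eqxx. Qed.
Lemma free_aug_fgen v : free_aug (fgen F v) = 0.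
Proof.
rewrite /free_aug mcoeffU; suff /negPf-> : fmu v != mone by [].
by apply/eqP => /(congr1 (@fdeg _)); rewrite fdegU fdeg1.
Qed.

Variable rel : relations F X.
Local Notation A := (presAlg rel).

Lemma pres_fox_exists (v : X) : exists D : T -> A,
  [/\ forall x y, D (x + y) = D x + D y,
      forall c x, D (c *: x) = c *: D x,
      forall x y, D (x * y) = pres_pi rel x * D y + free_aug y *: D x
    & forall u, D (fgen F u) = (u == v)%:R].
Proof.
apply: (fox_exists (@freeAlg_ind F X) (@freeAlg_hom F X) free_aug1 free_augD
         free_augZ free_augM free_aug_fgen).
- exact: rmorph1.
- exact: rmorphD.
- exact: pres_piZ.
- exact: rmorphM.
Qed.
Definition fox (v : X) : T -> A := projT1 (cid (pres_fox_exists v)).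

Lemma foxD v x y : fox v (x + y) = fox v x + fox v y.
Proof. by rewrite /fox; case: cid => D []. Qed.
Lemma foxZ v c x : fox v (c *: x) = c *: fox v x.
Proof. by rewrite /fox; case: cid => D []. Qed.
Lemma foxM v x y :
  fox v (x * y) = pres_pi rel x * fox v y + free_aug y *: fox v x.
Proof. by rewrite /fox; case: cid => D []. Qed.
Lemma fox_fgen v u : fox v (fgen F u) = (u == v)%:R.
Proof. by rewrite /fox; case: cid => D []. Qed.
Lemma fox_mul_gen v x b :
  fox v (x * fgen F b) = (v == b)%:R * pres_pi rel x.
Proof.
rewrite foxM fox_fgen free_aug_fgen scale0r addr0 eq_sym.
by case: eqP; rewrite ?mulr1 ?mul1r ?mulr0 ?mul0r.
Qed.
Lemma fox0 v : fox v 0 = 0.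
Proof. by rewrite -(scale0r 0) foxZ scale0r. Qed.
Lemma foxN v x : fox v (- x) = - fox v x.
Proof. by rewrite -scaleN1r foxZ scaleN1r. Qed.
Lemma foxB v x y : fox v (x - y) = fox v x - fox v y.
Proof. by rewrite foxD foxN. Qed.
Lemma fox_sum v (I : finType) (P : pred I) (G : I -> T) :
  fox v (\sum_(i | P i) G i) = \sum_(i | P i) fox v (G i).
Proof. by apply: (big_morph _ (foxD v) (fox0 v)). Qed.

(* Left syzygies of the generators come from the last letters of the defining
   relations: in [u * r * w] with [w] of positive degree the relation [r] stays
   in the coefficient, which vanishes in the quotient. *)
Lemma pres_syzygy (x : X -> A) : \sum_v x v * pgen rel v = 0 ->
  exists (n : nat) (y : 'I_n -> A) (r : 'I_n -> T),
    (forall i, rel (r i)) /\ (forall v, x v = \sum_i y i * fox v (r i)).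
Proof.
move=> x0; have /choice[z zE] v := pres_pi_surj (x v).
have : pres_pi rel (\sum_v z v * fgen F v) = 0.
  by rewrite rmorph_sum -[RHS]x0; apply: eq_bigr => v _; rewrite rmorphM zE.
move=> /pres_pi_eq0/relidealP[n [u [r [w [hr e]]]]].
exists n, (fun i => free_aug (w i) *: pres_pi rel (u i)), r; split=> // v.
have := congr1 (fox v) e; rewrite !fox_sum.
have -> : \sum_i fox v (z i * fgen F i) = x v.
  rewrite (bigD1 v) //= big1 => [|i /negPf ne]; last first.
    by rewrite foxM fox_fgen ne mulr0 add0r free_aug_fgen scale0r.
  by rewrite foxM fox_fgen eqxx mulr1 free_aug_fgen scale0r !addr0 -zE.
move=> ->; apply: eq_bigr => i _; rewrite foxM.
rewrite [pres_pi rel (_ * _)]rmorphM /= (pres_rel (hr i)) mulr0 mul0r add0r foxM.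
have -> : free_aug (r i) = 0 by apply: (is_rel_aug (hr i)).
by rewrite scale0r addr0 -scalerAl.
Qed.

End Fox.

(** * Linear algebra *)

Section LinearAlgebra.
Variable F : fieldType.

Lemma sum_enum_val (I : finType) (V : nmodType) (G : I -> V) :
  \sum_i G i = \sum_(k < #|I|) G (enum_val k).
Proof. exact: (reindex _ (onW_bij _ (enum_val_bij I))). Qed.

(** [S] is a bare predicate, so the basis is a row-free family inside [S] of maximal size; sizes are
    bounded by [#|N|], and a vector outside the span could be adjoined. *)
Lemma subspace_basis (N : finType) (S : (N -> F) -> Prop) :
    (forall x y, S x -> S y -> S (fun i => x i + y i)) ->
    (forall c x, S x -> S (fun i => c * x i)) ->
  exists (k : nat) (K : 'I_k -> N -> F),
    [/\ forall l, S (K l),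
        forall x, S x -> exists t : 'I_k -> F, forall i, x i = \sum_l t l * K l i
      & forall t : 'I_k -> F,
          (forall i, \sum_l t l * K l i = 0) -> forall l, t l = 0].
Proof.
move=> SD SZ; pose fn (v : 'rV[F]_#|N|) i := v 0 (enum_rank i).
pose P k := `[< exists2 K : 'M[F]_(k, #|N|),
  row_free K & forall l, S (fn (row l K)) >].
have exP : exists k, P k.
  exists 0%N; apply/asboolP; exists 0 => [|[]//].
  by rewrite /row_free mxrank0.
have ubP k : P k -> (k <= #|N|)%N.
  by move=> /asboolP[K /eqP rK _]; rewrite -{1}rK rank_leq_col.
case: (ex_maxnP exP ubP) => k /asboolP[K Kfree SK] kmax.
exists k, (fun l => fn (row l K)); split=> // [x Sx|t t0].
  pose v : 'rV_#|N| := \row_j x (enum_val j).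
  have [/submxP[t vt]|nvK] := boolP (v <= K)%MS.
    exists (fun l => t 0 l) => i.
    have -> : x i = v 0 (enum_rank i) by rewrite mxE enum_rankK.
    by rewrite vt mxE; apply: eq_bigr => l _; rewrite /fn mxE.
  have /kmax : P (1 + k)%N; last by rewrite add1n ltnn.
  apply/asboolP; exists (col_mx v K).
    apply: inj_row_free => u; rewrite -[u]hsubmxK mul_row_col.
    rewrite [lsubmx u]mx11_scalar mul_scalar_mx.
    set c := lsubmx u 0 0; set w := rsubmx u => e.
    have c0 : c = 0.
      apply/eqP/negP => /negP c0; case/negP: nvK; apply/submxP.
      exists (- c^-1 *: w); rewrite -scalemxAl -(addr0_eq e) scalerN scaleNr.
      by rewrite opprK scalerA mulVf // scale1r.
    move: e; rewrite c0 scale0r add0r => /eqP; rewrite mulmx_free_eq0 //.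
    by move=> /eqP->; rewrite raddf0 row_mx0.
  move=> l; case: (split_ordP l) => j ->; last by rewrite rowKd.
  rewrite rowKu (_ : fn _ = x) //; apply/funext => i.
  by rewrite /fn !mxE enum_rankK.
have : (\row_l t l) *m K = 0.
  apply/rowP => j; rewrite !mxE -[RHS](t0 (enum_val j)).
  by apply: eq_bigr => l _; rewrite /fn !mxE enum_valK.
move=> /eqP; rewrite mulmx_free_eq0 // => /eqP e l.
by have := congr1 (fun M : 'rV_k => M 0 l) e; rewrite !mxE.
Qed.

(* The coefficients [x], [y] range over an arbitrary vector space, that is the
   basis stays one after extension of scalars to any algebra. *)
Lemma kernel_basis (I J : finType) (M : I -> J -> F) :
  exists (k : nat) (K : 'I_k -> I -> F),
    [/\ forall l j, \sum_i K l i * M i j = 0,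
        forall (V : lmodType F) (x : I -> V),
          (forall j, \sum_i M i j *: x i = 0) ->
          exists y : 'I_k -> V, forall i, x i = \sum_l K l i *: y l
      & forall (V : lmodType F) (y : 'I_k -> V),
          (forall i, \sum_l K l i *: y l = 0) -> forall l, y l = 0].
Proof.
pose Mx := \matrix_(i < #|I|, j < #|J|) M (enum_val i) (enum_val j).
pose R := row_base (kermx Mx).
have Rfree : row_free R by apply: row_base_free.
have RM : R *m Mx = 0 by apply/sub_kermxP; rewrite eq_row_base.
exists _, (fun l i => R l (enum_rank i)); split=> [l j|V x x0|V y y0 l].
- have := congr1 (fun N : 'M_(_, _) => N l (enum_rank j)) RM; rewrite !mxE => e.
  rewrite -[RHS]e sum_enum_val; apply: eq_bigr => i _.
  by rewrite !mxE enum_valK enum_rankK.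
(* With [M^+] the pseudo-inverse, the rows of [1 - M M^+] lie in the kernel of [M], so this matrix
   is [D *m R]. A vector [x] killed by [M] equals [x (1 - M M^+)], hence has coordinates [x D]; only
   scalar matrices act on [x], so any [V] is allowed. *)
- have [D eD] : exists D, 1%:M - Mx *m pinvmx Mx = D *m R.
    apply/submxP; rewrite eq_row_base; apply/sub_kermxP.
    by rewrite mulmxBl mul1mx mulmxKpV // subrr.
  exists (fun l => \sum_j D (enum_rank j) l *: x j) => i.
  transitivity (\sum_j (D *m R) (enum_rank j) (enum_rank i) *: x j).
    rewrite -eD.
    have -> : \sum_j (1%:M - Mx *m pinvmx Mx) (enum_rank j) (enum_rank i) *: x j
       = \sum_j (j == i)%:R *: x j - \sum_j
           (Mx *m pinvmx Mx) (enum_rank j) (enum_rank i) *: x j.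
      rewrite -sumrB; apply: eq_bigr => j _.
      by rewrite -scalerBl !mxE (inj_eq enum_rank_inj).
    rewrite (bigD1 i) //= eqxx scale1r [X in _ + X - _]big1 => [|j /negPf->]; last first.
      by rewrite scale0r.
    rewrite addr0 (_ : \sum_j _ = 0) ?subr0 //.
    transitivity (\sum_j \sum_l pinvmx Mx l (enum_rank i) *:
                            (M j (enum_val l) *: x j)).
      apply: eq_bigr => j _; rewrite mxE scaler_suml; apply: eq_bigr => l _.
      by rewrite mxE enum_rankK scalerA mulrC.
    rewrite exchange_big big1 //= => l _.
    by rewrite -scaler_sumr x0 scaler0.
  transitivity (\sum_j \sum_l R l (enum_rank i) *: (D (enum_rank j) l *: x j)).
    apply: eq_bigr => j _; rewrite mxE scaler_suml; apply: eq_bigr => l _.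
    by rewrite scalerA mulrC.
  rewrite exchange_big; apply: eq_bigr => l _.
  by rewrite -scaler_sumr.
(* A right inverse of [R] recovers the coefficients, again by scalars only. *)
- have /row_freeP[C RC] := Rfree.
  transitivity (\sum_i C i l *: (\sum_l' R l' i *: y l')); last first.
    by rewrite big1 // => i _; rewrite -[i]enum_valK y0 scaler0.
  transitivity (\sum_l' (R *m C) l' l *: y l').
    rewrite RC (bigD1 l) //= mxE eqxx scale1r big1 ?addr0 // => l' /negPf ne.
    by rewrite mxE ne scale0r.
  transitivity (\sum_l' \sum_i C i l *: (R l' i *: y l')).
    apply: eq_bigr => l' _; rewrite mxE scaler_suml; apply: eq_bigr => i _.
    by rewrite scalerA mulrC.
  by rewrite exchange_big; apply: eq_bigr => i _; rewrite -scaler_sumr.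
Qed.

(** The cokernel of an injective matrix: a complement of the row space of [Nx] provides the
    basis. *)
Lemma has_dim_coker (A : algType F) (U : A -> Prop) (I K : finType)
    (g : I -> A) (N : K -> I -> F) :
    (forall x, U x <-> exists m : I -> F, x = \sum_i m i *: g i) ->
    (forall m : I -> F, \sum_i m i *: g i = 0 <->
       exists t : K -> F, forall i, m i = \sum_k t k * N k i) ->
    (forall t : K -> F, (forall i, \sum_k t k * N k i = 0) -> forall k, t k = 0) ->
  exists2 n, (n + #|K| = #|I|)%N & has_dim U n.
Proof.
move=> hU hker hN.
pose Nx := \matrix_(k < #|K|, i < #|I|) N (enum_val k) (enum_val i).
have Nfree : row_free Nx.
  apply: inj_row_free => t tN; apply/rowP => k; rewrite mxE.
  have := hN (fun k => t 0 (enum_rank k)) _ (enum_val k); rewrite enum_valK; apply.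
  move=> i; have := congr1 (fun M : 'rV_#|I| => M 0 (enum_rank i)) tN.
  rewrite !mxE => e; rewrite -[RHS]e sum_enum_val.
  by apply: eq_bigr => k' _; rewrite !mxE enum_valK enum_rankK.
pose Q := row_base (Nx^C)%MS.
exists (\rank (Nx^C)%MS).
  by rewrite mxrank_compl (eqP Nfree) subnK // -(eqP Nfree) rank_leq_col.
pose v (m : 'rV[F]_#|I|) := \sum_i m 0 i *: g (enum_val i).
have vD a b : v (a + b) = v a + v b.
  by rewrite -big_split; apply: eq_bigr => i _; rewrite mxE scalerDl.
have vE (m : 'rV_#|I|) : v m = \sum_i (m 0 (enum_rank i)) *: g i.
  by rewrite sum_enum_val; apply: eq_bigr => i _; rewrite enum_valK.
have v0 (m : 'rV_#|I|) : v m = 0 <-> (m <= Nx)%MS.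
  rewrite vE hker; split=> [[t tE]|/submxP[t ->]].
    apply/submxP; exists (\row_k t (enum_val k)); apply/rowP => i.
    rewrite mxE -[m 0 i](congr1 (m 0) (enum_valK i)) tE sum_enum_val.
    by apply: eq_bigr => k _; rewrite !mxE.
  exists (fun k => t 0 (enum_rank k)) => i; rewrite mxE [RHS]sum_enum_val.
  by apply: eq_bigr => k _; rewrite !mxE enum_valK enum_rankK.
exists (fun l => v (row l Q)).
have vQ (c : 'rV_(\rank (Nx^C)%MS)) : \sum_l c 0 l *: v (row l Q) = v (c *m Q).
  rewrite /v; under eq_bigr do rewrite scaler_sumr.
  rewrite exchange_big; apply: eq_bigr => i _; rewrite mxE scaler_suml.
  by apply: eq_bigr => l _; rewrite mxE scalerA.
split=> [x|c].
  rewrite hU; split=> [[m ->]|[c ->]].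
    pose mr : 'rV_#|I| := \row_i m (enum_val i).
    have -> : \sum_i m i *: g i = v mr.
      by rewrite vE; apply: eq_bigr => i _; rewrite mxE enum_rankK.
    have /sub_addsmxP[[a b] /= e] : (mr <= Nx + Q)%MS.
      rewrite (adds_eqmx (eqmx_refl _) (eq_row_base _)).
      by apply: submx_full; apply: addsmx_compl_full.
    exists (fun l => b 0 l); rewrite e vD vQ.
    by rewrite (v0 (a *m Nx)).2 ?add0r // submxMl.
  exists (fun i => ((\row_l c l) *m Q) 0 (enum_rank i)); rewrite -vE -vQ.
  by apply: eq_bigr => l _; rewrite mxE.
move=> c0; have : v ((\row_l c l) *m Q) = 0.
  by rewrite -vQ -[RHS]c0; apply: eq_bigr => l _; rewrite mxE.
move=> /v0 cN.
have : ((\row_l c l) *m Q <= Nx :&: (Nx^C))%MS.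
  by rewrite sub_capmx cN (submx_trans (submxMl _ _)) // eq_row_base.
rewrite capmx_compl submx0 mulmx_free_eq0 ?row_base_free // => /eqP e l.
by have := congr1 (fun M : 'rV_ _ => M 0 l) e; rewrite !mxE.
Qed.

(** Lets families of relations of different kinds sit side by side in a sum type [K], with [Q]
    selecting the independent ones. *)
Lemma has_dim_coker_in (A : algType F) (U : A -> Prop) (I K : finType)
    (Q : {pred K}) (g : I -> A) (N : K -> I -> F) :
    (forall x, U x <-> exists m : I -> F, x = \sum_i m i *: g i) ->
    (forall m : I -> F, \sum_i m i *: g i = 0 <->
       exists t : K -> F, forall i, m i = \sum_(k in Q) t k * N k i) ->
    (forall t : K -> F, (forall i, \sum_(k in Q) t k * N k i = 0) ->
       forall k, k \in Q -> t k = 0) ->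
  exists2 n, (n + #|Q| = #|I|)%N & has_dim U n.
Proof.
move=> hU hker hN.
pose ext (t : {k in Q} -> F) k := if insub k is Some k' then t k' else 0.
have extE t k : ext t (val k) = t k by rewrite /ext valK.
rewrite -card_sig.
apply: (@has_dim_coker A U I {k in Q} g (fun k => N (val k))) => // [m|t t0 k].
- rewrite hker; split=> [[t tE]|[t tE]].
    by exists (fun k => t (val k)) => i; rewrite tE big_sub.
  exists (ext t) => i; rewrite tE [RHS]big_sub.
  by apply: eq_bigr => k _; rewrite extE.
- rewrite -extE; apply: hN (valP k) => i; rewrite big_sub -[RHS](t0 i).
  by apply: eq_bigr => k' _; rewrite extE.
Qed.

End LinearAlgebra.

(** * Linear resolutions indexed by finite types *)

Section Koszul.
Variables (F : fieldType) (A : algType F) (gr : nat -> A -> Prop).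

Lemma koszul_fin (I : nat -> finType) (d : forall i, I i.+1 -> I i -> A) :
    #|I 0%N| = 1%N ->
    (forall i j k, gr 1%N (d i j k)) ->
    (forall x : I 0%N -> A, (forall j, augmentation_ideal gr (x j)) <->
       exists y : I 1%N -> A, forall j, x j = \sum_k y k * d 0%N k j) ->
    (forall i (x : I i.+1 -> A), (forall j, \sum_k x k * d i k j = 0) <->
       exists y : I i.+2 -> A, forall k, x k = \sum_l y l * d i.+1 l k) ->
  koszul gr.
Proof.
move=> I0 d1 dA dex.
pose D i := \matrix_(k < #|I i.+1|, j < #|I i|) d i (enum_val k) (enum_val j).
pose fn i (x : 'rV[A]_#|I i|) j := x 0 (enum_rank j).
have mulD i (x : 'rV[A]_#|I i.+1|) j :
    (x *m D i) 0 j = \sum_k fn _ x k * d i k (enum_val j).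
  by rewrite mxE [RHS]sum_enum_val; apply: eq_bigr => k _; rewrite !mxE /fn enum_valK.
have imD i (x : 'rV[A]_#|I i|) : (exists y, x = y *m D i) <->
    exists y : I i.+1 -> A, forall j, fn _ x j = \sum_k y k * d i k j.
  split=> [[y ->]|[y yE]].
    by exists (fn _ y) => j; rewrite /fn mulD enum_rankK.
  exists (\row_k y (enum_val k)); apply/rowP => j.
  rewrite mulD -[x 0 j](congr1 (x 0) (enum_valK j)) [LHS]yE.
  by apply: eq_bigr => k _; rewrite /fn mxE enum_rankK.
exists (fun i => #|I i|), D; split=> // [i j k|x|i x].
- by rewrite mxE.
- rewrite imD -dA; split=> h j; first exact: h.
  by rewrite -[j]enum_valK; apply: h.
- rewrite imD -dex; split=> h.
    by move=> j; rewrite -[j]enum_rankK -mulD h mxE.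
  by apply/rowP => j; rewrite mulD h mxE.
Qed.

End Koszul.

(** * Graded components and augmentation ideal of a generated algebra *)

Section Generated.
Variables (F : fieldType) (X : finType) (A : algType F) (g : X -> A).
Hypothesis A_ind : forall P : A -> Prop,
    P 1 -> (forall x y, P x -> P y -> P (x + y)) ->
    (forall c x, P x -> P (c *: x)) ->
    (forall v x, P x -> P (g v * x)) ->
  forall x, P x.

(** For the generators of a presentation this is convertible with [hcomp]. *)
Definition word_comp (n : nat) (y : A) : Prop :=
  exists c : n.-tuple X -> F, y = \sum_w c w *: \prod_(x <- w) g x.

Lemma word_comp0 n : word_comp n 0.
Proof. by exists (fun=> 0); rewrite big1 // => w _; rewrite scale0r. Qed.

Lemma word_compD n x y : word_comp n x -> word_comp n y -> word_comp n (x + y).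
Proof.
move=> [c ->] [d ->]; exists (fun w => c w + d w).
by rewrite -big_split; apply: eq_bigr => w _; rewrite scalerDl.
Qed.

Lemma word_compZ n a x : word_comp n x -> word_comp n (a *: x).
Proof.
move=> [c ->]; exists (fun w => a * c w).
by rewrite scaler_sumr; apply: eq_bigr => w _; rewrite scalerA.
Qed.

Lemma word_comp_sum n (I : finType) (P : pred I) (x : I -> A) :
  (forall i, P i -> word_comp n (x i)) -> word_comp n (\sum_(i | P i) x i).
Proof.
by move=> h; apply: (big_ind (word_comp n)) => //;
  [apply: word_comp0 | apply: word_compD].
Qed.

Lemma word_comp_word n (w : n.-tuple X) : word_comp n (\prod_(x <- w) g x).
Proof.
exists (fun w' => (w' == w)%:R); rewrite (bigD1 w) //= eqxx scale1r.
by rewrite [X in _ + X]big1 ?addr0 // => w' /negPf->; rewrite scale0r.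
Qed.

Lemma word_comp_gen v : word_comp 1 (g v).
Proof. by have := word_comp_word [tuple v]; rewrite big_seq1. Qed.

Lemma word_comp_cons n u x : word_comp n x -> word_comp n.+1 (g u * x).
Proof.
move=> [c ->]; rewrite mulr_sumr; apply: word_comp_sum => w _.
rewrite -scalerAr; apply: word_compZ.
by have := word_comp_word [tuple of u :: w]; rewrite big_cons.
Qed.

Lemma word_comp1P x : word_comp 1 x <-> exists c : X -> F, x = \sum_v c v *: g v.
Proof.
split=> [[c ->]|[c ->]]; last first.
  by apply: word_comp_sum => v _; apply/word_compZ/word_comp_gen.
exists (fun v => c [tuple v]).
rewrite (reindex (fun v => [tuple v])) /=; last first.
  exists (fun w => thead w) => // -[[|v []] // i] _.
  exact: val_inj.
by apply: eq_bigr => v _; rewrite big_seq1.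
Qed.

Lemma augmentation_idealP x : augmentation_ideal word_comp x <->
  exists y : X -> A, x = \sum_v y v * g v.
Proof.
(* Sequences on all of [nat], padded with zeros, let sums of different lengths be added. *)
have augP z : augmentation_ideal word_comp z <-> exists (n : nat) (y : nat -> A),
    (forall i, word_comp i.+1 (y i)) /\ z = \sum_(i < n) y i.
  split=> [[n [y [hy ->]]]|[n [y [hy ->]]]]; last first.
    by exists n, (fun i => y i); split=> // i; apply: hy.
  exists n, (fun i => if insub i is Some j then y j else 0); split=> [i|].
    case: insubP => [j _ <-|_]; [exact: hy|exact: word_comp0].
  by apply: eq_bigr => i _; rewrite valK.
have augD z t : augmentation_ideal word_comp z -> augmentation_ideal word_comp t ->
    augmentation_ideal word_comp (z + t).
  move=> /augP[m [y [hy ->]]] /augP[n [y' [hy' ->]]]; apply/augP.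
  exists (maxn m n), (fun i => (if (i < m)%N then y i else 0) +
                              (if (i < n)%N then y' i else 0)).
  split=> [i|].
    by apply: word_compD; case: ifP => _ //; apply: word_comp0.
  rewrite big_split /= -!big_mkcond /=; congr (_ + _).
    by rewrite (big_ord_widen (maxn m n)) // leq_maxl.
  by rewrite (big_ord_widen (maxn m n)) // leq_maxr.
have aug0 : augmentation_ideal word_comp 0.
  by exists 0%N, (fun=> 0); split=> [[]//|]; rewrite big_ord0.
have augZ c z : augmentation_ideal word_comp z -> augmentation_ideal word_comp (c *: z).
  move=> [n [y [hy ->]]]; exists n, (fun i => c *: y i).
  by rewrite scaler_sumr; split=> // i; apply: word_compZ.
have augM u z : augmentation_ideal word_comp z -> augmentation_ideal word_comp (g u * z).
  move=> /augP[n [y [hy ->]]]; apply/augP.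
  exists n.+1, (fun i => if i is j.+1 then g u * y j else 0); split=> [[|i]|].
  - exact: word_comp0.
  - exact: word_comp_cons.
  by rewrite big_ord_recl add0r mulr_sumr.
split=> [[n [y [hy ->]]]|[y ->]].
  pose S z := exists t : X -> A, z = \sum_v t v * g v.
  have SD z t : S z -> S t -> S (z + t).
    move=> [a ->] [b ->]; exists (fun v => a v + b v).
    by rewrite -big_split; apply: eq_bigr => v _; rewrite mulrDl.
  have S0 : S 0 by exists (fun=> 0); rewrite big1 // => v _; rewrite mul0r.
  apply: (big_ind S) => // i _; have [c ->] := hy i.
  apply: (big_ind S) => // w _; have : size w = i.+1 by rewrite size_tuple.
  (* Splitting off the last letter puts the word into the left ideal of the generators. *)
  case/lastP: (tval w) => // s v _.
  exists (fun u => (u == v)%:R *: (c w *: \prod_(x <- s) g x)).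
  rewrite [RHS](bigD1 v) //= eqxx scale1r [X in _ + X]big1 => [|u /negPf->]; last first.
    by rewrite scale0r mul0r.
  by rewrite addr0 -cats1 big_cat big_seq1 -scalerAl.
apply: (big_ind (augmentation_ideal word_comp)) => // v _.
elim/A_ind: (y v) => [|a b ha hb|c a ha|u a ha].
- exists 1%N, (fun=> g v); rewrite mul1r big_ord1; split=> // i.
  by rewrite ord1; apply: word_comp_gen.
- by rewrite mulrDl; apply: augD.
- by rewrite -scalerAl; apply: augZ.
- by rewrite -mulrA; apply: augM.
Qed.

End Generated.

(** * Syzygies and Hilbert series of B(Gamma) *)

(* [e] stands for the edge relation between vertices of positive level and [a]
   for the top vertex, so that V_2 is [e a] and V_1 is [bottom]. *)
Section VertexAlgebra.
Variables (F : fieldType) (X : finType) (e : rel X) (a : X).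
Hypothesis no_edge_to_top : forall u, ~~ e u a.
Hypothesis edge_to_second : forall u b, e a b -> e u b -> u = a.
Hypothesis edge_from : forall u v, e u v -> u = a \/ e a u.

Variables (B : algType F) (g : X -> B) (eps : B -> F).
Hypothesis B_ind : forall P : B -> Prop,
    P 1 -> (forall x y, P x -> P y -> P (x + y)) ->
    (forall c x, P x -> P (c *: x)) ->
    (forall v x, P x -> P (g v * x)) ->
  forall x, P x.
Hypothesis eps1 : eps 1 = 1.
Hypothesis epsD : forall x y, eps (x + y) = eps x + eps y.
Hypothesis epsZ : forall c x, eps (c *: x) = c * eps x.
Hypothesis epsM : forall x y, eps (x * y) = eps x * eps y.
Hypothesis eps_gen : forall v, eps (g v) = 0.
Hypothesis gM0 : forall u v, ~~ e u v -> g u * g v = 0.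
Hypothesis gMsum0 : forall u, g u * \sum_(v | e u v) g v = 0.
Hypothesis g_syzygy : forall x : X -> B, \sum_v x v * g v = 0 ->
  exists (Y : X -> X -> B) (z : X -> B),
    (forall u v, e u v -> Y u v = z u) /\ (forall v, x v = \sum_u Y u v * g u).

Let eps0 : eps 0 = 0.
Proof. by rewrite -(scale0r 0) epsZ mul0r. Qed.

Let epsN x : eps (- x) = - eps x.
Proof. by rewrite -scaleN1r epsZ mulN1r. Qed.

Let eps_sum (I : finType) (x : I -> B) : eps (\sum_i x i) = \sum_i eps (x i).
Proof. by apply: (big_morph _ epsD eps0). Qed.

Let eps_lin (x : X -> B) : eps (\sum_u x u * g u) = 0.
Proof. by rewrite eps_sum big1 // => u _; rewrite epsM eps_gen mulr0. Qed.

(** By [g_syzygy] all coefficients of a syzygy lie in the left ideal of the generators, where [eps]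
    vanishes. This replaces the comparison of homogeneous components, as [B] carries no grading
    here. *)
Lemma eps_coef_eq (x x' : X -> B) :
  \sum_u x u * g u = \sum_u x' u * g u -> forall u, eps (x u) = eps (x' u).
Proof.
move=> h u; have [|Y [z [_ Yz]]] := g_syzygy (x := fun v => x v - x' v).
  under eq_bigr do rewrite mulrBl.
  by rewrite sumrB h subrr.
have := congr1 eps (Yz u); rewrite eps_lin epsD epsN => /eqP.
by rewrite subr_eq0 => /eqP.
Qed.

Lemma gens_free (l : X -> F) : \sum_u l u *: g u = 0 -> forall u, l u = 0.
Proof.
move=> l0 u; have := @eps_coef_eq (fun u => (l u)%:A) (fun=> 0) _ u.
rewrite epsZ eps1 mulr1 eps0; apply.
rewrite [RHS]big1 => [|i _]; last by rewrite mul0r.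
by rewrite -[RHS]l0; apply: eq_bigr => v _; rewrite -scalerAl mul1r.
Qed.

Lemma eps_decomp x : exists y : X -> B, x = (eps x)%:A + \sum_u y u * g u.
Proof.
elim/B_ind: x => [|x x' [y xy] [y' xy']|c x [y xy]|v x [y xy]].
- exists (fun=> 0); rewrite eps1 scale1r big1 ?addr0 // => u _.
  by rewrite mul0r.
- exists (fun u => y u + y' u); rewrite {1}xy {1}xy' epsD scalerDl addrACA -big_split.
  by congr (_ + _); apply: eq_bigr => u _; rewrite mulrDl.
- exists (fun u => c *: y u); rewrite {1}xy epsZ scalerDr scalerA; congr (_ + _).
  by rewrite scaler_sumr; apply: eq_bigr => u _; rewrite scalerAl.
- exists (fun u => eps x *: (u == v)%:R + g v * y u).
  rewrite epsM eps_gen mul0r scale0r add0r {1}xy mulrDr -scalerAr mulr1.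
  under [RHS]eq_bigr do rewrite mulrDl.
  rewrite big_split /= [X in _ = X + _](bigD1 v) //= eqxx -scalerAl mul1r.
  rewrite [X in _ + X + _]big1 => [|u /negPf->]; last by rewrite scaler0 mul0r.
  rewrite addr0 mulr_sumr; congr (_ + _); apply: eq_bigr => u _.
  by rewrite mulrA.
Qed.

(** Applying [eps] to the coefficients supplied by [g_syzygy] shows that [l u v] depends only on [u]
    along edges, and then [gMsum0] kills the sum; the terms with [w], of higher degree, are
    invisible to [eps]. *)
Lemma quadratic_part0 (l : X -> X -> F) (w : X -> X -> B) :
    (forall u v, eps (w u v) = 0) ->
    \sum_v (\sum_u (l u v *: g u + w u v * g u)) * g v = 0 ->
  \sum_v (\sum_u l u v *: g u) * g v = 0.
Proof.
move=> w0 /g_syzygy[Y [z [Yz xY]]].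
have lY u v : l u v = eps (Y u v).
  transitivity (eps ((l u v)%:A + w u v)).
    by rewrite epsD epsZ eps1 mulr1 w0 addr0.
  have := @eps_coef_eq (fun u => (l u v)%:A + w u v) (fun u => Y u v).
  apply; rewrite -xY; apply: eq_bigr => u' _.
  by rewrite mulrDl -scalerAl mul1r.
under eq_bigr do rewrite mulr_suml.
rewrite exchange_big big1 //= => u _.
rewrite (bigID (e u)) /= [X in _ + X]big1 => [|v /gM0 uv0]; last first.
  by rewrite -scalerAl uv0 scaler0.
rewrite addr0; transitivity (eps (z u) *: (g u * \sum_(v | e u v) g v)); last first.
  by rewrite gMsum0 scaler0.
rewrite mulr_sumr scaler_sumr.
by apply: eq_bigr => v uv; rewrite lY Yz // scalerAl.
Qed.

(** The last two letters are stripped in turn. The first use of [g_syzygy] gives elements [z b]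
    depending on [b] alone; the second, for fixed [c], gives [z' c a] depending on [c] alone. On a
    path a b c, comparing coefficients of [g a] writes [m b c] as a contribution [p b] of [z b] plus
    a contribution [q c] of [z' c a]. *)
Lemma cubic_relation (m : X -> X -> F) :
    \sum_c (\sum_b m b c *: (g a * g b)) * g c = 0 ->
  exists p q : X -> F, forall b c, e a b -> e b c -> m b c = p b + q c.
Proof.
move=> /g_syzygy[Y [z [Yz xY]]].
have /choice[Y' hY'] (c : X) : exists Y' : X -> X -> B, exists z' : X -> B,
    (forall u b, e u b -> Y' u b = z' u) /\
    (forall b, m b c *: g a - Y b c = \sum_u Y' u b * g u).
  apply: g_syzygy; under eq_bigr do rewrite mulrBl -scalerAl.
  by rewrite sumrB xY subrr.
have [z' hz'] := choice hY'; have /choice[y hy] := eps_decomp.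
exists (fun b => eps (y (z b) a)), (fun c => eps (z' c a)) => b c ab bc.
have [Yz' xY'] := hz' c; have := xY' b; rewrite (Yz _ _ bc) -(Yz' _ _ ab) => h.
have z0 : eps (z b) = 0.
  have := congr1 eps h; rewrite eps_lin epsD epsN epsZ eps_gen mulr0 add0r.
  by move/eqP; rewrite oppr_eq0 => /eqP.
have ga : m b c *: g a = \sum_u (if u == a then (m b c)%:A else 0) * g u.
  rewrite (bigD1 a) //= eqxx -scalerAl mul1r big1 ?addr0 // => u /negPf->.
  by rewrite mul0r.
have := @eps_coef_eq (fun u => if u == a then (m b c)%:A else 0)
  (fun u => y (z b) u + Y' c u b); rewrite -ga => /(_ _ a).
rewrite eqxx epsZ eps1 mulr1 epsD; apply.
under eq_bigr do rewrite mulrDl.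
rewrite big_split /= -h; have := hy (z b); rewrite z0 scale0r add0r => <-.
by rewrite addrC subrK.
Qed.

(** The [p] part dies by the relation at [b], the [q] part by the relation at [a]. *)
Lemma cubic_relation_converse (p q : X -> F) :
  \sum_c (\sum_b (p b + q c) *: (g a * g b)) * g c = 0.
Proof.
under eq_bigr do (rewrite mulr_suml; under eq_bigr do rewrite scalerDl mulrDl).
under eq_bigr do rewrite big_split; rewrite big_split /= exchange_big /=.
rewrite [X in X + _]big1 => [|b _]; last first.
  rewrite (bigID (e b)) /= [X in _ + X]big1 => [|c /gM0 bc0]; last first.
    by rewrite -scalerAl -mulrA bc0 mulr0 scaler0.
  rewrite addr0; transitivity (p b *: (g a * (g b * \sum_(v | e b v) g v))).
    rewrite !mulr_sumr.
    by rewrite scaler_sumr; apply: eq_bigr => c _; rewrite -scalerAl mulrA.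
  by rewrite gMsum0 mulr0 scaler0.
rewrite add0r big1 // => c _; rewrite (bigID (e a)) /= [X in _ + X]big1 => [|b /gM0 ab0]; last first.
  by rewrite ab0 scaler0 mul0r.
rewrite addr0 -mulr_suml -scaler_sumr -mulr_sumr gMsum0.
by rewrite scaler0 mul0r.
Qed.

Definition bottom c := (c != a) && ~~ e a c.

Lemma edge_from_bottom c v : bottom c -> ~~ e c v.
Proof.
case/andP=> /eqP ca nac; apply/negP => /edge_from[//|].
exact/negP.
Qed.

Lemma edge_second_bottom b v : e a b -> e b v -> bottom v.
Proof.
move=> ab bv; have ba : b != a.
  by apply/eqP => eba; have := no_edge_to_top a; rewrite -{2}eba ab.
apply/andP; split.
  by apply/eqP => eva; have := no_edge_to_top b; rewrite -eva bv.
by apply/negP => av; case/eqP: ba; apply: edge_to_second bv.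
Qed.

Local Notation lin l := (\sum_u l u *: g u).

(** A nonzero word not ending in a bottom letter is empty, a single letter, or [g a * g b] with
    [e a b]. All other nonzero words go into the last sum, which every linear factor on its right
    kills, since no edge leaves a bottom vertex. *)
Lemma normal_form x : exists (x0 : F) (l t : X -> F) (y : X -> B),
  (forall c, ~~ bottom c -> y c = 0) /\
  x = x0%:A + lin l + g a * lin t + \sum_c y c * g c.
Proof.
have sumD (V : nmodType) (f h : X -> V) : \sum_u (f u + h u) = \sum_u f u + \sum_u h u.
  exact: big_split.
elim/B_ind: x => [|x x' [x0 [l [t [y [y0 xE]]]]] [x0' [l' [t' [y' [y0' xE']]]]]
  |c x [x0 [l [t [y [y0 xE]]]]]|v x [x0 [l [t [y [y0 xE]]]]]].
- exists 1, (fun=> 0), (fun=> 0), (fun=> 0); split=> //.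
  rewrite !big1 ?mulr0 ?addr0 ?scale1r // => u _; by rewrite ?scale0r ?mul0r.
- exists (x0 + x0'), (fun u => l u + l' u), (fun u => t u + t' u),
    (fun u => y u + y' u); split=> [c hc|]; first by rewrite y0 // y0' // addr0.
  have linD f h : \sum_u (f u + h u) *: g u = lin f + lin h.
    by rewrite -sumD; apply: eq_bigr => u _; rewrite scalerDl.
  under [X in _ = _ + X]eq_bigr do rewrite mulrDl.
  rewrite xE xE' scalerDl !linD sumD mulrDr addrACA; congr (_ + _).
  by rewrite addrACA; congr (_ + _); rewrite addrACA.
- exists (c * x0), (fun u => c * l u), (fun u => c * t u), (fun u => c *: y u).
  split=> [d hd|]; first by rewrite y0 // scaler0.
  rewrite xE !scalerDr scalerA !scaler_sumr scalerAr scaler_sumr.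
  by congr (_ + _ + _ * _ + _); apply: eq_bigr => u _; rewrite ?scalerA ?scalerAl.
exists 0, (fun u => x0 * (u == v)%:R), (fun u => if (v == a) && e a u then l u else 0),
  (fun c => (if bottom c then l c *: g v else 0) + g v * y c).
split=> [c hc|]; first by rewrite (negPf hc) y0 // mulr0 addr0.
have -> : lin (fun u => x0 * (u == v)%:R) = x0 *: g v.
  rewrite (bigD1 v) //= eqxx mulr1 big1 ?addr0 // => u /negPf->.
  by rewrite mulr0 scale0r.
under [X in _ = _ + X]eq_bigr do rewrite mulrDl.
rewrite scale0r add0r sumD xE !mulrDr -scalerAr mulr1 mulrA.
have -> : g v * g a = 0 by apply: gM0; apply: no_edge_to_top.
rewrite mul0r addr0 mulr_sumr addrA; congr (_ + _); last first.
  by apply: eq_bigr => c _; rewrite mulrA.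
rewrite -addrA [g v * _]mulr_sumr [g a * _]mulr_sumr -sumD; congr (_ + _); apply: eq_bigr => u _.
rewrite -!scalerAr /bottom.
have [->|ua /=] := eqVneq u a.
  rewrite (negPf (no_edge_to_top a)) andbF scale0r mul0r addr0.
  by rewrite gM0 ?scaler0 //; apply: no_edge_to_top.
have [au|nau] /= := boolP (e a u); last first.
  by rewrite andbF scale0r add0r -scalerAl.
rewrite andbT mul0r addr0; have [->//|va] := eqVneq v a.
rewrite scale0r gM0 ?scaler0 //; apply/negP => vu; case/eqP: va.
exact: edge_to_second vu.
Qed.

(* The last condition, that the rows span V_1 times the standard basis, makes the
   cubic syzygies consequences of the linear ones. *)
Definition good (M N : finType) (d : M -> N -> B) : Prop :=
  [/\ exists D : M -> N -> X -> F, forall k j, d k j = lin (D k j),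
      forall s : M -> F, (forall j, \sum_k s k *: d k j = 0) -> forall k, s k = 0
    & forall c j0, bottom c -> exists s : M -> F,
        forall j, \sum_k s k *: d k j = if j == j0 then g c else 0].

Lemma good_generators : good (fun (v : X) (_ : unit) => g v).
Proof.
have delta c : \sum_u (u == c)%:R *: g u = g c.
  rewrite (bigD1 c) //= eqxx scale1r big1 ?addr0 // => u /negPf->.
  by rewrite scale0r.
split=> [|s /(_ tt)|c [] _]; last 1 first.
- by exists (fun v => (v == c)%:R) => -[]; rewrite delta.
- by exists (fun v _ u => (u == v)%:R) => v _; rewrite delta.
- exact: gens_free.
Qed.

(** * Syzygies of a good matrix *)

Section NextSyzygies.
Variables (M N : finType) (d : M -> N -> B).
Hypothesis gd : good d.

(** The rows of [d'] are a basis of the linear syzygies [S]. An arbitrary syzygy is cut along its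
    normal form: the constants vanish, the linear part lies in [S], the part ending in bottom
    letters is a combination of elements of [S], and the part [g a * lin t] is rewritten as [g a]
    times a linear syzygy. *)
Lemma good_next : exists (k : nat) (d' : 'I_k -> M -> B), good d' /\
  forall x : M -> B, (forall j, \sum_k x k * d k j = 0) <->
    exists y : 'I_k -> B, forall k, x k = \sum_l y l * d' l k.
Proof.
have [[D dE] dfree dbot] := gd.
pose L (l : X * M -> F) k := \sum_u l (u, k) *: g u.
pose S (l : X * M -> F) := forall j, \sum_k L l k * d k j = 0.
have SD l l' : S l -> S l' -> S (fun i => l i + l' i).
  move=> h h' j; apply: etrans (etrans (congr2 +%R (h j) (h' j)) (addr0 0)).
  rewrite -big_split; apply: eq_bigr => k _; rewrite /= -mulrDl -big_split.
  by congr (_ * _); apply: eq_bigr => u _; rewrite scalerDl.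
have SZ c l : S l -> S (fun i => c * l i).
  move=> h j; apply: etrans (etrans (congr1 (GRing.scale c) (h j)) (scaler0 _ c)).
  rewrite [RHS]scaler_sumr; apply: eq_bigr => k _.
  rewrite [RHS]scalerAl [c *: L _ _]scaler_sumr.
  by congr (_ * _); apply: eq_bigr => u _; rewrite scalerA.
have [p [K [SK Kspan Kfree]]] := subspace_basis SD SZ.
have LS (l : X * M -> F) (t : 'I_p -> F) :
    (forall i, l i = \sum_j t j * K j i) -> forall k, L l k = \sum_j t j *: L (K j) k.
  move=> lE k; rewrite /L; under eq_bigr do rewrite lE scaler_suml.
  rewrite exchange_big; apply: eq_bigr => j _; rewrite scaler_sumr.
  by apply: eq_bigr => u _; rewrite scalerA.
pose unitl c k0 (i : X * M) : F := ((i.1 == c) && (i.2 == k0))%:R.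
have Lunit c k0 k : L (unitl c k0) k = if k == k0 then g c else 0.
  rewrite /L /unitl /=; case: eqP => _; last first.
    by rewrite big1 // => u _; rewrite andbF scale0r.
  rewrite (bigD1 c) //= eqxx scale1r big1 ?addr0 // => u /negPf->.
  by rewrite scale0r.
have bot_d c k j : bottom c -> g c * d k j = 0.
  move=> hc; rewrite dE mulr_sumr big1 // => v _.
  by rewrite -scalerAr gM0 ?scaler0 //; apply: edge_from_bottom.
have Sunit c k0 : bottom c -> S (unitl c k0).
  move=> hc j; rewrite big1 // => k _; rewrite Lunit.
  by case: eqP => _; rewrite ?mul0r ?bot_d.
exists p, (fun l k => L (K l) k); split.
  split=> [|s s0|c k0 hc].
  - by exists (fun l k u => K l (u, k)).
  - apply: Kfree => -[u k].
    apply: (@gens_free (fun u => \sum_l s l * K l (u, k))).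
    rewrite -[RHS](s0 k); under eq_bigr do rewrite scaler_suml.
    rewrite exchange_big; apply: eq_bigr => l _; rewrite scaler_sumr.
    by apply: eq_bigr => u' _; rewrite scalerA.
  have [t tE] := Kspan _ (Sunit c k0 hc); exists t => k.
  by rewrite -(LS _ _ tE) Lunit.
move=> x; split=> [xd|[y yE] j]; last first.
  under eq_bigr do rewrite yE mulr_suml.
  rewrite exchange_big big1 //= => l _.
  under eq_bigr do rewrite -mulrA.
  by rewrite -mulr_sumr (SK l) mulr0.
pose Im (x : M -> B) := exists y : 'I_p -> B, forall k, x k = \sum_l y l * L (K l) k.
have ImD x1 x2 x3 : (forall k, x3 k = x1 k + x2 k) -> Im x1 -> Im x2 -> Im x3.
  move=> e3 [y1 e1] [y2 e2]; exists (fun l => y1 l + y2 l) => k.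
  rewrite e3 e1 e2 -big_split; apply: eq_bigr => l _; by rewrite mulrDl.
have ImM c x1 x2 : (forall k, x2 k = c * x1 k) -> Im x1 -> Im x2.
  move=> e2 [y1 e1]; exists (fun l => c * y1 l) => k.
  by rewrite e2 e1 mulr_sumr; apply: eq_bigr => l _; rewrite mulrA.
have Im0 : Im (fun=> 0) by exists (fun=> 0) => k; rewrite big1 // => l _; rewrite mul0r.
have Im_sum (I : finType) (x' : I -> M -> B) :
    (forall i, Im (x' i)) -> Im (fun k => \sum_i x' i k).
  move=> /choice[y' y'E]; exists (fun l => \sum_i y' i l) => k.
  under eq_bigr do rewrite y'E; rewrite exchange_big.
  by apply: eq_bigr => l _; rewrite mulr_suml.
have ImS l : S l -> Im (L l).
  move=> /Kspan[t tE]; exists (fun j => (t j)%:A) => k; rewrite (LS _ _ tE).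
  by apply: eq_bigr => j _; rewrite -scalerAl mul1r.
have /choice[x0 /choice[l0 /choice[t0 /choice[y hx]]]] := fun k => normal_form (x k).
have dsum (z : M -> B) j :
    \sum_k z k * d k j = \sum_v (\sum_k D k j v *: z k) * g v.
  under [RHS]eq_bigr do rewrite mulr_suml.
  rewrite [RHS]exchange_big; apply: eq_bigr => k _; rewrite dE mulr_sumr.
  by apply: eq_bigr => v _; rewrite -scalerAr scalerAl.
have eps_l f : eps (lin f) = 0.
  by rewrite eps_sum big1 // => u _; rewrite epsZ eps_gen mulr0.
have eps_x k : eps (x k) = x0 k.
  have [_ ->] := hx k; rewrite !epsD epsZ eps1 mulr1 eps_l epsM eps_gen mul0r.
  by rewrite eps_lin !addr0.
(* Taking [eps] of the coefficients gives a scalar relation between the rows of [d], excluded by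
   [dfree]. *)
have x00 k : x0 k = 0.
  apply: dfree => j; rewrite (_ : \sum_k _ = \sum_k (x0 k)%:A * d k j); last first.
    by apply: eq_bigr => k' _; rewrite -scalerAl mul1r.
  rewrite dsum big1 // => v _.
  have := @eps_coef_eq (fun v => \sum_k D k j v *: x k) (fun=> 0) _ v.
  rewrite -dsum xd eps0 big1 => [|u _]; last by rewrite mul0r.
  move=> /(_ erefl); rewrite eps_sum => h.
  rewrite (_ : \sum_k _ = (\sum_k D k j v * x0 k)%:A); last first.
    by rewrite scaler_suml; apply: eq_bigr => k' _; rewrite scalerA.
  rewrite (_ : \sum_k _ = 0) ?scale0r ?mul0r // -[RHS]h.
  by apply: eq_bigr => k' _; rewrite epsZ eps_x.
pose u1 k := lin (l0 k); pose u2 k := g a * lin (t0 k).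
have xE k : x k = u1 k + u2 k + \sum_c y k c * g c.
  by have [_ ->] := hx k; rewrite x00 scale0r add0r.
have y_d j k : (\sum_c y k c * g c) * d k j = 0.
  rewrite mulr_suml big1 // => c _; have [hc|/(hx k).1 ->] := boolP (bottom c).
    by rewrite -mulrA bot_d // mulr0.
  by rewrite !mul0r.
have ud j : \sum_k (u1 k + u2 k) * d k j = 0.
  rewrite -[RHS](xd j); apply: eq_bigr => k _.
  by rewrite xE [RHS]mulrDl y_d addr0.
pose m j u v := \sum_k t0 k u * D k j v.
(* As [d] is linear, [u1] contributes in degree two and [u2] in degree three; [quadratic_part0]
   separates them. *)
have u1d j : \sum_k u1 k * d k j = 0.
  have := @quadratic_part0 (fun u v => \sum_k l0 k u * D k j v)
    (fun u v => m j u v *: g a).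
  have -> : \sum_v (\sum_u (\sum_k l0 k u * D k j v) *: g u) * g v = \sum_k u1 k * d k j.
    rewrite dsum; apply: eq_bigr => v _; congr (_ * _).
    under [LHS]eq_bigr do rewrite scaler_suml.
    rewrite exchange_big; apply: eq_bigr => k _; rewrite scaler_sumr.
    by apply: eq_bigr => u _; rewrite scalerA mulrC.
  apply=> [u v|]; first by rewrite epsZ eps_gen mulr0.
  rewrite -[RHS](ud j) dsum; apply: eq_bigr => v _; congr (_ * _).
  rewrite big_split; under [RHS]eq_bigr do rewrite scalerDr.
  rewrite [RHS]big_split; congr (_ + _).
    under [LHS]eq_bigr do rewrite scaler_suml.
    rewrite exchange_big; apply: eq_bigr => k _; rewrite scaler_sumr.
    by apply: eq_bigr => u _; rewrite scalerA mulrC.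
  under [LHS]eq_bigr do rewrite /m scaler_suml mulr_suml.
  rewrite exchange_big; apply: eq_bigr => k _; rewrite /u2 mulr_sumr scaler_sumr.
  by apply: eq_bigr => u _; rewrite -scalerAr scalerA scalerAl mulrC.
have u2d j : \sum_k u2 k * d k j = 0.
  by have := ud j; under eq_bigr do rewrite mulrDl; rewrite big_split /= u1d add0r.
have /choice[p' /choice[q hpq]] : forall j, exists p' q : X -> F,
    forall b c, e a b -> e b c -> m j b c = p' b + q c.
  move=> j; apply: cubic_relation; rewrite -[RHS](u2d j) dsum.
  apply: eq_bigr => v _; congr (_ * _).
  under [LHS]eq_bigr do rewrite /m scaler_suml.
  rewrite exchange_big; apply: eq_bigr => k _; rewrite /u2 mulr_sumr scaler_sumr.
  by apply: eq_bigr => u _; rewrite -scalerAr scalerA mulrC.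
(* The third condition of [good] realises each bottom [g c] in column [j] by scalars; weighted with
   [q] they give [s], whose combination of the rows of [d] reproduces the [q] part of [m]. *)
have /choice[s1 hs1] (i : X * N) : exists s : M -> F, forall j,
    \sum_k s k *: d k j = if (j == i.2) && bottom i.1 then g i.1 else 0.
  have [hc|_] := boolP (bottom i.1).
    by have [s hs] := dbot _ i.2 hc; exists s => j; rewrite hs andbT.
  by exists (fun=> 0) => j; rewrite andbF big1 // => k _; rewrite scale0r.
pose s k := \sum_i q i.2 i.1 * s1 i k.
have sd j : \sum_k s k *: d k j = \sum_(c | bottom c) q j c *: g c.
  under [LHS]eq_bigr do rewrite scaler_suml.
  rewrite exchange_big /=.
  transitivity (\sum_i q i.2 i.1 *: (if (j == i.2) && bottom i.1 then g i.1 else 0)).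
    apply: eq_bigr => i _; rewrite -hs1 scaler_sumr.
    by apply: eq_bigr => k _; rewrite scalerA.
  rewrite -(pair_bigA _ (fun c i2 => q i2 c *:
    (if (j == i2) && bottom c then g c else 0))) /= [RHS]big_mkcond.
  apply: eq_bigr => c _; rewrite (bigD1 j) //= eqxx [X in _ + X]big1 => [|i /negPf ij].
    by rewrite addr0 /=; case: ifP; rewrite ?scaler0.
  by rewrite eq_sym ij scaler0.
(* Subtracting [s k] from the coefficients of all second layer vertices does not change the product
   with [g a], which kills the sum of that layer. It removes [q] from [m], and what is left,
   depending on [b] only, dies by the relation at [b]. *)
pose l3 (i : X * M) := if e a i.1 then t0 i.2 i.1 - s i.2 else 0.
have Sl3 : S l3.
  move=> j; transitivity (\sum_(b | e a b) \sum_k (t0 k b - s k) *: (g b * d k j)).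
    rewrite exchange_big; apply: eq_bigr => k _; rewrite mulr_suml [RHS]big_mkcond.
    apply: eq_bigr => b _; rewrite /l3 /=; case: ifP => _.
      by rewrite scalerAl.
    by rewrite scale0r mul0r.
  rewrite big1 // => b ab.
  under eq_bigr do rewrite scalerBl; rewrite sumrB.
  have -> : \sum_k t0 k b *: (g b * d k j) = \sum_(v | e b v) (p' j b + q j v) *: (g b * g v).
    transitivity (\sum_v m j b v *: (g b * g v)).
      under [RHS]eq_bigr do rewrite /m scaler_suml.
      rewrite [RHS]exchange_big; apply: eq_bigr => k _; rewrite dE mulr_sumr scaler_sumr.
      by apply: eq_bigr => v _; rewrite -scalerAr scalerA.
    rewrite [RHS]big_mkcond; apply: eq_bigr => v _; case: (boolP (e b v)) => [bv|/gM0 ->].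
      by rewrite (hpq _ _ _ ab bv).
    by rewrite scaler0.
  have -> : \sum_k s k *: (g b * d k j) = \sum_(v | e b v) q j v *: (g b * g v).
    transitivity (g b * \sum_k s k *: d k j).
      by rewrite mulr_sumr; apply: eq_bigr => k _; rewrite scalerAr.
    rewrite sd mulr_sumr [LHS]big_mkcond [RHS]big_mkcond; apply: eq_bigr => v _.
    have [bv|nbv] := boolP (e b v).
      by rewrite (edge_second_bottom ab bv) scalerAr.
    by case: ifP => // _; rewrite -scalerAr gM0 // scaler0.
  rewrite -sumrB; transitivity (p' j b *: (g b * \sum_(v | e b v) g v)).
    rewrite mulr_sumr scaler_sumr; apply: eq_bigr => v _.
    by rewrite -scalerBl addrK.
  by rewrite gMsum0 scaler0.
have l3E k : g a * L l3 k = u2 k.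
  transitivity (\sum_(b | e a b) (t0 k b *: (g a * g b) - s k *: (g a * g b))).
    rewrite mulr_sumr [RHS]big_mkcond; apply: eq_bigr => b _; rewrite /l3 /=.
    by case: ifP => _; rewrite -scalerAr ?scalerBl ?scale0r.
  rewrite sumrB [X in _ - X](_ : _ = 0); last first.
    by rewrite -scaler_sumr -mulr_sumr gMsum0 scaler0.
  rewrite subr0 /u2 mulr_sumr big_mkcond; apply: eq_bigr => b _.
  by case: ifP => [_|/negbT/gM0 ab0]; rewrite -scalerAr // ab0 scaler0.
have Sl1 : S (fun i => l0 i.2 i.1) by [].
apply: (ImD _ _ _ xE); last first.
  apply: (ImM 1 (fun k => \sum_c \sum_k0 y k0 c * L (unitl c k0) k)) => [k|].
    rewrite mul1r; apply: eq_bigr => c _; rewrite (bigD1 k) //= Lunit eqxx.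
    rewrite big1 ?addr0 // => k' /negPf kk'.
    by rewrite Lunit eq_sym kk' mulr0.
  apply: (Im_sum _ (fun c k => \sum_k0 y k0 c * L (unitl c k0) k)) => c.
  apply: (Im_sum _ (fun k0 k => y k0 c * L (unitl c k0) k)) => k0.
  have [hc|/(hx k0).1 ->] := boolP (bottom c).
    apply: (ImM (y k0 c) (L (unitl c k0))) => // ; exact/ImS/Sunit.
  by apply: (ImM 0 (fun=> 0)) => // k; rewrite !mul0r.
apply: (ImD u1 u2) => //; first exact: ImS Sl1.
by apply: (ImM (g a) (L l3)) => [k|]; [rewrite l3E | apply: ImS].
Qed.

End NextSyzygies.
(** The index types change at every step, so they are bundled with the matrix to allow iteration. *)
Record syzygies := Syzygies {
  syz_row : finType; syz_col : finType;
  syz_mx : syz_row -> syz_col -> B;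
  syz_good : good syz_mx }.

Definition next_rank (s : syzygies) := cid (good_next (syz_good s)).
Definition next_mx (s : syzygies) := cid (svalP (next_rank s)).
Definition next_syzygies (s : syzygies) : syzygies :=
  Syzygies (svalP (next_mx s)).1.

Lemma koszul_vertexAlgebra : koszul (word_comp g).
Proof.
pose s i := iter i next_syzygies (Syzygies good_generators).
(* The column type of the next matrix is by conversion the row type of the present one, so [syz_mx]
   has the type of a differential. *)
apply: (@koszul_fin F B (word_comp g) (fun i => syz_col (s i)) (fun i => @syz_mx (s i))).
- by rewrite /= card_unit.
- move=> i j k; have [[D dE] _ _] := syz_good (s i).
  by rewrite dE; apply/word_comp1P; exists (D j k).
- move=> x; split=> [/(_ tt)/(augmentation_idealP B_ind)[y xE]|[y xE] j].
    by exists y => -[].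
  by apply/(augmentation_idealP B_ind); exists y; rewrite xE.
- move=> i x; exact: (svalP (next_mx (s i))).2.
Qed.

(** * Dimensions of the graded components of B *)

Hypothesis edge_below : forall b, (b == a) || e a b -> exists c, e b c.

Lemma has_dim_comp0 : has_dim (word_comp g 0) 1.
Proof.
exists (fun=> 1); split=> [x|c].
  split=> [[c ->]|[c ->]].
    exists (fun=> c [tuple]); rewrite big_ord1 (bigD1 [tuple]) //= big_nil.
    by rewrite [X in _ + X]big1 ?addr0 // => w /eqP[]; rewrite tuple0.
  rewrite big_ord1; apply: word_compZ.
  by have := word_comp_word g [tuple]; rewrite big_nil.
rewrite big_ord1 => /(congr1 eps); rewrite epsZ eps1 mulr1.
by rewrite -(scale0r 0) epsZ mul0r => h i; rewrite ord1.
Qed.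

Lemma has_dim_comp1 : has_dim (word_comp g 1) #|X|.
Proof.
have sum0 (V : nmodType) (f : void -> V) : \sum_k f k = 0 by rewrite big1 // => -[].
have [x|m|t _ []//|n] := @has_dim_coker _ _ (word_comp g 1) X void g
    (fun k _ => match k with end).
- exact: word_comp1P.
- split=> [m0|[t mE]].
    by exists (fun=> 0) => i; rewrite sum0; apply: gens_free m0 i.
  by rewrite big1 // => i _; rewrite mE sum0 scale0r.
- by rewrite card_void addn0 => ->.
Qed.

(** A directed path within the positive levels has at most three vertices. *)
Lemma has_dim_comp_ge4 n : has_dim (word_comp g n.+4) 0.
Proof.
have w0 x1 x2 x3 x4 z : g x1 * (g x2 * (g x3 * (g x4 * z))) = 0.
  have [h12|/gM0 h12] := boolP (e x1 x2); last by rewrite mulrA h12 mul0r.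
  have [h23|/gM0 h23] := boolP (e x2 x3); last first.
    by rewrite [g x2 * _]mulrA h23 mul0r mulr0.
  rewrite [g x3 * (_ * _)]mulrA [g x3 * _]gM0 ?mul0r ?mulr0 //.
  apply: edge_from_bottom; apply: (edge_second_bottom _ h23).
  have [ea|//] := edge_from h23; by move: h12; rewrite ea (negPf (no_edge_to_top _)).
exists (fun=> 0); split=> [x|c _ []//]; split=> [[c ->]|[c ->]]; last first.
  by rewrite big_ord0; apply: word_comp0.
exists (fun=> 0); rewrite big_ord0 big1 // => -[[|x1 [|x2 [|x3 [|x4 s]]]] // i] _.
by rewrite /= !big_cons w0 scaler0.
Qed.

Lemma word_comp2P x : word_comp g 2 x <->
  exists m : X * X -> F, x = \sum_i m i *: (g i.1 * g i.2).
Proof.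
split=> [[c ->]|[m ->]]; last first.
  apply: word_comp_sum => -[u v] _ /=; apply: word_compZ.
  by have := word_comp_word g [tuple u; v]; rewrite !big_cons big_nil mulr1.
exists (fun i => c [tuple i.1; i.2]).
rewrite (reindex (fun i : X * X => [tuple i.1; i.2])) /=; last first.
  exists (fun w => (tnth w ord0, tnth w (lift ord0 ord0))) => [[]|] // -[[|u [|v []]] // i] _.
  exact: val_inj.
by apply: eq_bigr => -[u v] _; rewrite !big_cons big_nil mulr1.
Qed.

Lemma word_comp3P x : word_comp g 3 x <->
  exists m : X * X -> F, x = \sum_i m i *: (g a * g i.1 * g i.2).
Proof.
split=> [[c ->]|[m ->]]; last first.
  apply: word_comp_sum => -[u v] _ /=; apply: word_compZ.
  have := word_comp_word g [tuple a; u; v].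
  by rewrite !big_cons big_nil mulr1 mulrA.
exists (fun i => c [tuple a; i.1; i.2]).
rewrite (reindex (fun i : X * (X * X) => [tuple i.1; i.2.1; i.2.2])) /=; last first.
  exists (fun w => (tnth w ord0, (tnth w (lift ord0 ord0), tnth w (lift ord0 (lift ord0 ord0)))))
    => [[? []]|] // -[[|u [|v [|w []]]] // i] _.
  exact: val_inj.
pose h u (i : X * X) := c [tuple u; i.1; i.2] *: (g u * g i.1 * g i.2).
rewrite (eq_bigr (fun i => h i.1 i.2)) => [|[u [v w]] _]; last first.
  by rewrite /h !big_cons big_nil mulr1 mulrA.
rewrite -(pair_bigA _ h) /= (bigD1 a) //= [X in _ + X]big1 ?addr0 // => u ua.
rewrite big1 // => -[v w] _; rewrite /h /=.
have [uv|/gM0->] := boolP (e u v); last by rewrite mul0r scaler0.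
have [vw|/gM0 vw0] := boolP (e v w); last by rewrite -mulrA vw0 mulr0 scaler0.
case: (edge_from vw) => [va|av].
  by move: uv; rewrite va (negPf (no_edge_to_top _)).
by case/eqP: ua; apply: edge_to_second av uv.
Qed.

Lemma card_pairs (P : rel X) : #|[pred p : X * X | P p.1 p.2]| = \sum_x #|P x|.
Proof.
rewrite -sum1_card big_mkcond -(pair_bigA _ (fun x y => if P x y then 1 else 0))%N /=.
by apply: eq_bigr => x _; rewrite -big_mkcond sum1_card.
Qed.

(** Edges from level two to level one, given by their endpoints; for simple edges their number is
    [|E_2|]. *)
Let P3 (p : X * X) := e a p.1 && e p.1 p.2.

Lemma card_edges : #|[pred p : X * X | e p.1 p.2]| = (#|e a| + #|P3|)%N.
Proof.
rewrite card_pairs (bigD1 a) //=; congr (_ + _)%N.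
rewrite (card_pairs (fun x y => e a x && e x y)) [RHS](bigD1 a) //=.
rewrite [X in _ = (X + _)%N](_ : _ = 0%N) ?add0n; last first.
  by apply: eq_card0 => y; rewrite /in_mem /= (negPf (no_edge_to_top _)).
apply: eq_bigr => x xa; have [ax|nax] := boolP (e a x).
  exact: eq_card.
rewrite [RHS]eq_card0 //.
apply: eq_card0 => y; rewrite /in_mem /=; apply/negP => /edge_from[/eqP|].
  exact/negP.
exact/negP.
Qed.

(** There is one relation for each non-edge and one for each vertex of level at least two,
    independent because such a vertex has an edge below it. Of the [#|e a| + #|P3|] adjacent pairs
    this leaves [#|P3| - 1]. *)
Lemma has_dim_comp2 : exists2 n, (n + 1)%N = #|P3| & has_dim (word_comp g 2) n.
Proof.
pose top2 u := (u == a) || e a u.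
pose Q (k : X * X + X) := match k with inl p => ~~ e p.1 p.2 | inr u => top2 u end.
pose N (k : X * X + X) (i : X * X) : F :=
  match k with inl p => (p == i)%:R | inr u => ((u == i.1) && e i.1 i.2)%:R end.
have sumN (t : X * X + X -> F) i : \sum_(k in Q) t k * N k i =
    if e i.1 i.2 then t (inr i.1) else t (inl i).
  rewrite big_sumType /=.
  have -> : \sum_(p | inl p \in Q) t (inl p) * (p == i)%:R =
      if e i.1 i.2 then 0 else t (inl i).
    rewrite big_mkcond (bigD1 i) //= eqxx mulr1 big1 ?addr0 => [|p /negPf->].
      by rewrite /in_mem /=; case: (e _ _).
    by rewrite mulr0 if_same.
  have -> : \sum_(u | inr u \in Q) t (inr u) * ((u == i.1) && e i.1 i.2)%:R =
      if e i.1 i.2 then t (inr i.1) else 0.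
    rewrite big_mkcond (bigD1 i.1) //= eqxx big1 ?addr0 => [|u /negPf->]; last first.
      by rewrite mulr0 if_same.
    rewrite /in_mem /= /top2; case: ifP => [|/negbT]; last first.
      case: ifP => // /edge_from h; rewrite negb_or => /andP[/eqP].
      by case: h => [//|->].
    by move=> _; case: (e i.1 i.2); rewrite ?mulr1 ?mulr0 ?addr0.
  by case: ifP; rewrite ?add0r ?addr0.
have [||t t0|n] := @has_dim_coker_in _ _ (word_comp g 2) (X * X)%type _ Q
    (fun i => g i.1 * g i.2) N.
- exact: word_comp2P.
- move=> m; split=> [m0|[t tE]].
    have : \sum_v (\sum_u m (u, v) *: g u) * g v = 0.
      rewrite -[RHS]m0; under eq_bigr do rewrite mulr_suml.
      rewrite exchange_big (pair_bigA _ (fun u v => m (u, v) *: g u * g v)).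
      by apply: eq_bigr => -[u v] _; rewrite scalerAl.
    move=> /g_syzygy[Y [z [Yz mY]]].
    exists (fun k => match k with inl p => m p | inr u => eps (z u) end) => -[u v].
    rewrite sumN /=; case: ifP => // uv; rewrite -(Yz _ _ uv).
    have := @eps_coef_eq (fun u => (m (u, v))%:A) (fun u => Y u v) _ u.
    rewrite epsZ eps1 mulr1; apply; rewrite -mY.
    by apply: eq_bigr => u' _; rewrite -scalerAl mul1r.
  transitivity (\sum_u \sum_v m (u, v) *: (g u * g v)).
    by rewrite pair_bigA; apply: eq_bigr => -[].
  rewrite big1 // => u _; transitivity (t (inr u) *: (g u * \sum_(v | e u v) g v)).
    rewrite mulr_sumr scaler_sumr [RHS]big_mkcond; apply: eq_bigr => v _.
    rewrite tE sumN /=; case: ifP => // /negbT/gM0 ->.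
    by rewrite scaler0.
  by rewrite gMsum0 scaler0.
- case=> [p|u] Qk.
    by have := t0 p; rewrite sumN (negPf Qk).
  by have [c uc] := edge_below Qk; have := t0 (u, c); rewrite sumN uc.
- have -> : #|Q| = (#|[predC [pred p : X * X | e p.1 p.2]]| + #|top2|)%N.
    by rewrite -sum1_card big_sumType /= !sum1_card; congr (_ + _)%N; apply: eq_card.
  have -> : #|top2| = #|e a|.+1.
    have ha : a \in top2 by rewrite /in_mem /= /top2 eqxx.
    rewrite -!sum1_card (bigD1 a ha) /= add1n; congr _.+1.
    apply: eq_bigl => u; rewrite /in_mem /= /top2.
    have [->|_] := eqVneq u a; last by rewrite andbT.
    by rewrite andbF (negPf (no_edge_to_top _)).
  rewrite -(cardC [pred p : X * X | e p.1 p.2]) card_edges => hn; exists n => //.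
  by move: #|e a| #|[predC _]| hn => *; lia.
Qed.

Section DegreeThree.
Hypothesis edge_above : forall c, bottom c -> exists2 b, e a b & e b c.
Hypothesis connected : forall f : X -> F,
  (forall b b' c, e a b -> e a b' -> e b c -> e b' c -> f b = f b') ->
  forall b b', e a b -> e a b' -> f b = f b'.

(** A function [p_b + q_c] is unchanged when a constant moves from [p] to [q]. Connectivity makes
    this the only ambiguity, and the normalisation [p b0 = 0] removes it; hence the summand 1 in the
    cubic coefficient. *)
Lemma has_dim_comp3 : exists2 n, (n + (#|bottom| + #|e a|))%N = #|P3|.+1
  & has_dim (word_comp g 3) n.
Proof.
have [b0 ab0] : exists b, e a b.
  by apply: edge_below; rewrite eqxx.
pose Q (k : X * X + (X + X)) := match k with inl p => ~~ P3 p
  | inr (inl b) => e a b && (b != b0) | inr (inr c) => bottom c end.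
pose N (k : X * X + (X + X)) (i : X * X) : F := match k with inl p => (p == i)%:R
  | inr (inl b) => ((b == i.1) && P3 i)%:R
  | inr (inr c) => ((c == i.2) && P3 i)%:R end.
pose pt (t : X * X + (X + X) -> F) b := if b == b0 then 0 else t (inr (inl b)).
pose qt (t : X * X + (X + X) -> F) c := t (inr (inr c)).
have sumN t i : \sum_(k in Q) t k * N k i =
    if P3 i then pt t i.1 + qt t i.2 else t (inl i).
  rewrite !big_sumType /=.
  have -> : \sum_(p | inl p \in Q) t (inl p) * (p == i)%:R =
      if P3 i then 0 else t (inl i).
    rewrite big_mkcond (bigD1 i) //= eqxx mulr1 big1 ?addr0 => [|p /negPf->].
      by rewrite /in_mem /=; case: (P3 i).
    by rewrite mulr0 if_same.
  have -> : \sum_(b | inr (inl b) \in Q) t (inr (inl b)) * ((b == i.1) && P3 i)%:R =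
      if P3 i then pt t i.1 else 0.
    rewrite big_mkcond (bigD1 i.1) //= eqxx [X in _ + X]big1 => [|u /negPf->]; last first.
      by rewrite mulr0 if_same.
    rewrite addr0 /in_mem /= /pt /P3; case: eqP => _; rewrite ?andbF ?if_same ?andbT //.
    by case: (e a i.1) => //=; case: (e i.1 i.2); rewrite ?mulr1 ?mulr0.
  have -> : \sum_(c | inr (inr c) \in Q) t (inr (inr c)) * ((c == i.2) && P3 i)%:R =
      if P3 i then qt t i.2 else 0.
    rewrite big_mkcond (bigD1 i.2) //= eqxx [X in _ + X]big1 => [|u /negPf->]; last first.
      by rewrite mulr0 if_same.
    rewrite addr0 /in_mem /=; case: (boolP (P3 i)) => [/andP[ab bc]|_].
      by rewrite (edge_second_bottom ab bc) mulr1.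
    by rewrite mulr0 if_same.
  by case: ifP; rewrite ?add0r ?addr0.
have cubic m : \sum_i m i *: (g a * g i.1 * g i.2) =
    \sum_c (\sum_b m (b, c) *: (g a * g b)) * g c.
  under [RHS]eq_bigr do rewrite mulr_suml.
  rewrite exchange_big (pair_bigA _ (fun b c => m (b, c) *: (g a * g b) * g c)).
  by apply: eq_bigr => -[b c] _; rewrite scalerAl.
have [||t t0|n] := @has_dim_coker_in _ _ (word_comp g 3) (X * X)%type _ Q
    (fun i => g a * g i.1 * g i.2) N.
- exact: word_comp3P.
- move=> m; rewrite cubic; split=> [/(@cubic_relation (fun b c => m (b, c)))|[t tE]].
    move=> [p [q mE]].
    (* The constant [p b0] is shifted into [q] to meet the normalisation. *)
    exists (fun k => match k with inl i => m i | inr (inl b) => p b - p b0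
                     | inr (inr c) => q c + p b0 end) => -[b c].
    rewrite sumN; case: ifP => // /andP[/= ab bc]; rewrite mE // /pt /qt.
    by case: eqP => [->|_]; [rewrite add0r addrC | rewrite addrA addrAC subrK].
  rewrite -[RHS](@cubic_relation_converse (pt t) (qt t)).
  apply: eq_bigr => c _; rewrite !mulr_suml; apply: eq_bigr => b _.
  rewrite tE sumN /P3 /=; case: ifP => //; rewrite -!scalerAl.
  have [ab /= /negbT/gM0 bc0|/gM0 -> _] := boolP (e a b).
    by rewrite -mulrA bc0 mulr0 !scaler0.
  by rewrite mul0r !scaler0.
- have pq b c : e a b -> e b c -> pt t b + qt t c = 0.
    by move=> ab bc; rewrite -[RHS](t0 (b, c)) sumN /P3 /= ab bc.
  (* [pt t b] equals [- qt t c] for every [c] below [b], so it agrees on second layer vertices with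
     a common vertex below. *)
  have p0 b : e a b -> pt t b = 0.
    move=> ab; transitivity (pt t b0); last by rewrite /pt eqxx.
    apply: connected ab ab0 => b1 b2 c ab1 ab2 bc1 bc2.
    by apply: (@addIr _ (qt t c)); rewrite !pq.
  case=> [p|[b|c]] Qk.
  + by have := t0 p; rewrite sumN (negPf Qk).
  + by case/andP: Qk => ab /negPf bb0; have := p0 b ab; rewrite /pt bb0.
  + have [b ab bc] := edge_above Qk; have := pq b c ab bc.
    by rewrite p0 // add0r.
- have -> : #|Q| = (#|[predC P3]| + (#|e a|.-1 + #|bottom|))%N.
    rewrite -(sum1_card Q) !big_sumType /= !sum1_card; congr (_ + (_ + _))%N.
    have hb : b0 \in e a by [].
    rewrite -!sum1_card [in RHS](bigD1 b0 hb) /= add0n.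
    exact: eq_bigl.
  have := cardC P3; have : (0 < #|e a|)%N by apply/card_gt0P; exists b0.
  move=> ea hc hn; exists n => //.
  by move: #|P3| #|e a| #|[predC P3]| #|bottom| #|{: X * X}| ea hc hn => *; lia.
Qed.

End DegreeThree.
End VertexAlgebra.

(** * The presentation of B and its syzygies *)

Section PresentationB.
Variables (G : layeredGraph) (F : fieldType).
Local Notation B := (algB G F).
Local Notation rel := (B_relations G F).
Local Notation g := (pgen rel).

Lemma algB_gM0 u v : ~~ adj (val u) (val v) -> g u * g v = 0.
Proof.
move=> uv; rewrite -!pres_pi_fgen -rmorphM; apply: pres_rel.
by left; exists u, v.
Qed.

(** At level one no relation is imposed, but the sum is empty, as vertices of level zero are not
    generators; all generators can thus be treated alike. *)
Lemma algB_gMsum0 (u : posVertex G) :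
  g u * \sum_(v : posVertex G | adj (val u) (val v)) g v = 0.
Proof.
have [hu|hu] := ltnP 1 (level (val u)).
  rewrite (eq_bigr (fun v => pres_pi rel (fgen F v))) // -pres_pi_fgen.
  rewrite -rmorph_sum -rmorphM; apply: pres_rel.
  by right; exists u.
rewrite big1 ?mulr0 // => v /existsP[e /andP[/eqP eu /eqP ev]].
by move: hu (valP v); rewrite -eu -ev level_etail ltnS leqn0 /= lt0n => /eqP->.
Qed.

(** Derivatives of the two kinds of relations: [u v] without an edge contributes [u] at [v] alone,
    while [u] times the sum contributes [u] equally at all [v] below [u]. So [Y u v] is free off the
    edges and constant along those out of [u]. *)
Lemma algB_syzygy (x : posVertex G -> B) : \sum_v x v * g v = 0 ->
  exists (Y : posVertex G -> posVertex G -> B) (z : posVertex G -> B),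
    (forall u v, adj (val u) (val v) -> Y u v = z u) /\
    (forall v, x v = \sum_u Y u v * g u).
Proof.
move=> /pres_syzygy[n [y [r [hr xE]]]].
pose S (x : posVertex G -> B) := exists (Y : posVertex G -> posVertex G -> B)
  (z : posVertex G -> B), (forall u v, adj (val u) (val v) -> Y u v = z u) /\
    (forall v, x v = \sum_u Y u v * g u).
have Sfox i : S (fun v => fox rel v (r i)).
  have gE u w : \sum_u' (if u' == u then w else 0) * g u' = w * g u.
    rewrite (bigD1 u) //= eqxx big1 ?addr0 // => u' /negPf->.
    by rewrite mul0r.
  case: (hr i) => [[u [v [uv ->]]]|[u [hu ->]]].
    exists (fun u' v' => if u' == u then (v == v')%:R else 0), (fun=> 0); split=> [u' v' uv'|v'].
      case: eqP => // eu; case: eqP => // ev.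
      by move: uv'; rewrite eu -ev (negPf uv).
    rewrite foxM free_aug_fgen scale0r addr0 fox_fgen gE -pres_pi_fgen.
    by case: eqP; rewrite ?mulr1 ?mulr0 ?mul1r ?mul0r.
  exists (fun u' v' => if u' == u then (adj (val u) (val v'))%:R else 0),
    (fun u' => (u' == u)%:R); split=> [u' v' uv'|v'].
    by case: eqP uv' => // -> ->.
  rewrite foxM fox_sum gE.
  have -> : free_aug (\sum_(w : posVertex G | adj (val u) (val w)) fgen F w) = 0.
    have aug0 : free_aug (0 : freeAlg F (posVertex G)) = 0 by exact: mcoeff0.
    rewrite (big_morph _ (@free_augD F _) aug0) big1 // => w _.
    exact: free_aug_fgen.
  rewrite scale0r addr0 -pres_pi_fgen.
  have -> : \sum_(w : posVertex G | adj (val u) (val w)) fox rel v' (fgen F w) =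
     (adj (val u) (val v'))%:R.
    rewrite big_mkcond (bigD1 v') //= fox_fgen eqxx big1 => [|w /negPf ne].
      by rewrite addr0; case: ifP.
    by rewrite fox_fgen ne if_same.
  by case: (adj _ _); rewrite ?mulr1 ?mulr0 ?mul1r ?mul0r.
have /choice[Y /choice[z hYz]] := Sfox.
exists (fun u v => \sum_i y i * Y i u v), (fun u => \sum_i y i * z i u).
split=> [u v uv|v]; first by apply: eq_bigr => i _; rewrite (hYz i).1.
rewrite xE; under [RHS]eq_bigr do rewrite mulr_suml.
rewrite exchange_big; apply: eq_bigr => i _; rewrite (hYz i).2 mulr_sumr.
by apply: eq_bigr => u _; rewrite mulrA.
Qed.

Lemma algB_augmentation : exists eps : B -> F,
  [/\ eps 1 = 1, forall x y, eps (x + y) = eps x + eps y,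
      forall c x, eps (c *: x) = c * eps x,
      forall x y, eps (x * y) = eps x * eps y & forall v, eps (g v) = 0].
Proof.
have [||eps [eps_gen epsZ]] := @presAlg_hom F _ rel F idfun (fun=> 0).
- by move=> c x; rewrite mulrC.
- move=> phi phig r [[u [v [_ ->]]]|[v [_ ->]]];
    by rewrite rmorphM phig mul0r.
exists eps; split=> //; [exact: rmorph1|exact: rmorphD|exact: rmorphM].
Qed.

End PresentationB.

(** * Layered graphs with three levels *)

Section LayeredGraph.
Variable G : layeredGraph.
Local Notation V := (vertex G).

Lemma adjP (u v : V) : reflect (exists e, etail e = u /\ ehead e = v) (adj u v).
Proof.
apply: (iffP existsP) => -[e]; first by case/andP=> /eqP <- /eqP <-; exists e.
by case=> <- <-; exists e; rewrite !eqxx.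
Qed.

Lemma adj_level (u v : V) : adj u v -> level u = (level v).+1.
Proof. by case/adjP=> e [<- <-]; apply: level_etail. Qed.

Lemma connect_level (u v : V) : connect (@adj G) u v ->
  u = v \/ (level v < level u)%N.
Proof.
case/connectP=> p; elim: p u => [|w p IHp] u /=; first by move=> _ ->; left.
case/andP=> uw pw lw; right; rewrite (adj_level uw).
by case: (IHp w pw lw) => [->//|]; apply: leqW.
Qed.

(** Each edge of a path drops one level. This turns the order in the hypotheses into adjacency. *)
Lemma above_adj (u v : V) : level u = (level v).+1 -> above u v -> adj u v.
Proof.
move=> luv /existsP[w /andP[uw /connect_level[<-//|]]].
by have := adj_level uw; rewrite luv => -[->]; rewrite ltnn.
Qed.

Variable a : V.
Hypothesis hunif : uniform G.
Hypothesis hlevel : forall v : V, (level v <= 3)%N.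
Hypothesis hmin : exists! v : V, minimal v.
Hypothesis hmin0 : forall v : V, minimal v -> v \in layer G 0.
Hypothesis htop : layer G 3 = [set a].
Hypothesis habove : forall b : V, b \in layer G 2 -> above a b.

Lemma level_top v : (level v == 3) = (v == a).
Proof. by rewrite -in_set1 -htop inE. Qed.

Lemma level_a : level a = 3.
Proof. by apply/eqP; rewrite level_top. Qed.

Lemma adj_top b : adj a b = (level b == 2).
Proof.
apply/idP/idP => [/adj_level|/eqP lb]; first by rewrite level_a => -[<-].
apply: above_adj; first by rewrite level_a lb.
by apply: habove; rewrite inE lb.
Qed.

Lemma out_edge (v : V) : (0 < level v)%N -> exists w, adj v w.
Proof.
rewrite lt0n => lv; have : ~ minimal v.
  by move/hmin0; rewrite inE (negPf lv).
move/asboolPn/existsp_asboolPn => [u /negP]; rewrite negbK.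
by case/existsP=> w /andP[vw _]; exists w.
Qed.

Lemma bottom_unique (v w : V) : level v = 0%N -> level w = 0%N -> v = w.
Proof.
have lev0 (u : V) : level u = 0%N -> minimal u.
  move=> lu w'; apply/negP => /existsP[x /andP[ux _]].
  by have := adj_level ux; rewrite lu.
have [x [_ xu]] := hmin.
by move=> /lev0/xu <- /lev0/xu <-.
Qed.

(** Uniformity is applied to edges leaving [a]: their heads exhaust the second layer, and neighbours
    in a down-up sequence share a vertex below. An arbitrary [T] serves scalars for [B] and
    polynomials for [A]. *)
Lemma second_layer_connected (T : Type) (f : V -> T) :
    (forall b b' c : V, level b = 2 -> adj b c -> adj b' c -> f b = f b') ->
  forall b b' : V, level b = 2 -> level b' = 2 -> f b = f b'.
Proof.
move=> hf b b' lb lb'.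
have fpath (s : seq V) (u : V) : level u = 2 -> path (@down_up G) u s -> f u = f (last u s).
  elim: s u => [|v s IHs] u lu //= /andP[/andP[/eqP luv /existsP[w hw]] ps].
  have /and3P[/eqP lw uw vw] := hw; rewrite -(IHs v) -?luv //.
  by apply: (hf u v w) => //; apply: above_adj; rewrite -?luv.
have /adjP[e [ea eb]] : adj a b by rewrite adj_top lb.
have /adjP[e' [ea' eb']] : adj a b' by rewrite adj_top lb'.
have [s [ps es _]] := hunif (etrans ea (esym ea')).
by rewrite -eb' -es -fpath // eb.
Qed.

Local Notation X := (posVertex G).

Lemma level_a_pos : (0 < level a)%N.
Proof. by rewrite level_a. Qed.

Definition topv : X := Sub a level_a_pos.

Let e (u v : X) := adj (val u) (val v).

Lemma posVertex_no_edge_to_top u : ~~ e u topv.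
Proof.
apply/negP => /adj_level; rewrite level_a => lu.
by have := hlevel (val u); rewrite lu.
Qed.

Lemma posVertex_edge_to_second u b : e topv b -> e u b -> u = topv.
Proof.
rewrite /e adj_top => /eqP lb /adj_level; rewrite lb => lu.
by apply: val_inj; apply/eqP; rewrite -level_top lu.
Qed.

Lemma posVertex_edge_from u v : e u v -> u = topv \/ e topv u.
Proof.
rewrite /e adj_top => /adj_level lu; have := hlevel (val u); rewrite leq_eqVlt.
rewrite level_top => /orP[/eqP ua|]; first by left; apply: val_inj.
by have := valP v; move: lu => -> /= lv lt2; right; lia.
Qed.

Lemma posVertex_edge_below b : (b == topv) || e topv b -> exists c, e b c.
Proof.
rewrite /e adj_top => hb; have lb : (1 < level (val b))%N.
  by case/orP: hb => [/eqP->|/eqP->] //; rewrite level_a.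
have [c bc] := out_edge (ltnW lb).
have lc : (0 < level c)%N by have := adj_level bc; lia.
by exists (Sub c lc).
Qed.

Lemma posVertex_bottom c : bottom e topv c = (level (val c) == 1).
Proof.
rewrite /bottom /e adj_top -val_eqE /= -level_top.
by have := valP c; have := hlevel (val c); case: (level _) => [|[|[|[|]]]].
Qed.

Lemma posVertex_connected (T : Type) (t0 : T) (f : X -> T) :
    (forall b b' c, e topv b -> e topv b' -> e b c -> e b' c -> f b = f b') ->
  forall b b', e topv b -> e topv b' -> f b = f b'.
Proof.
move=> hf b b'; rewrite /e !adj_top => /eqP lb /eqP lb'.
(* [t0] is the default at level zero, which is never met in the second layer. *)
pose f' (v : V) := if insub v is Some u then f u else t0.
have f'E (u : X) : f u = f' (val u) by rewrite /f' valK.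
rewrite !f'E; apply: second_layer_connected lb lb' => v v' c lv vc v'c.
have lc : level c = 1%N by have := adj_level vc; lia.
have lv' : level v' = 2 by have := adj_level v'c; lia.
have pv : (0 < level v)%N by rewrite lv.
have pv' : (0 < level v')%N by rewrite lv'.
have pc : (0 < level c)%N by rewrite lc.
rewrite -[v](SubK X pv) -[v'](SubK X pv') -!f'E.
by apply: (hf _ _ (Sub c pc)); rewrite /e ?adj_top //= ?lv ?lv'.
Qed.

Hypothesis hsimple : simple_edges G.

Lemma card_pos_layer i : (0 < i)%N ->
  #|[pred v : X | level (val v) == i]| = #|layer G i|.
Proof.
move=> i0; rewrite -(card_imset _ val_inj); apply: eq_card => v.
rewrite [in RHS]inE; apply/imsetP/eqP => [[u]|lv]; first by rewrite inE => /eqP<- ->.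
have pv : (0 < level v)%N by rewrite lv.
by exists (Sub v pv); rewrite ?inE /= ?lv.
Qed.

(** Simplicity identifies an edge with its pair of endpoints, and edges out of the second layer end
    in level one, so nothing is lost in [posVertex]. *)
Lemma card_second_edges :
  #|(fun p : X * X => e topv p.1 && e p.1 p.2)| = #|edges_from G 2|.
Proof.
pose h (p : X * X) := (val p.1, val p.2).
have h_inj : injective h.
  move=> [u v] [u' v'] /pair_equal_spec[/val_inj eu /val_inj ev].
  by congr pair.
pose k (f : edge G) := (etail f, ehead f).
have k_inj : injective k by move=> f f' []; apply: hsimple.
rewrite -(card_imset _ h_inj) -(card_imset _ k_inj); apply: eq_card => -[u v].
apply/imsetP/imsetP => [[[x y]]|[f]].
  move=> pxy; have : e topv x && e x y by [].
  rewrite {1}/e adj_top => /andP[/eqP lx /adjP[f [fx fy]]] [-> ->].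
  by exists f; [rewrite !inE fx lx | rewrite /k fx fy].
rewrite !inE => /eqP lf [-> ->].
have lh : level (ehead f) = 1%N by have := level_etail f; lia.
have pt : (0 < level (etail f))%N by rewrite lf.
have ph : (0 < level (ehead f))%N by rewrite lh.
exists (Sub (etail f) pt, Sub (ehead f) ph) => //.
suff : e topv (Sub (etail f) pt) && e (Sub (etail f) pt) (Sub (ehead f) ph) by [].
by rewrite {1}/e adj_top /= lf; apply/adjP; exists f.
Qed.

(** * Koszulness and Hilbert series of B for the graph *)

Variable F : fieldType.

Lemma koszul_algB : koszul (@grB G F).
Proof.
have [eps [eps1 epsD epsZ epsM eps_gen]] := algB_augmentation G F.
exact: (koszul_vertexAlgebra posVertex_no_edge_to_top posVertex_edge_to_second posVertex_edge_from
  (@presAlg_ind _ _ _) eps1 epsD epsZ epsM eps_gen (@algB_gM0 G F)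
  (@algB_gMsum0 G F) (@algB_syzygy G F)).
Qed.

(** A vertex [c] of level one with nothing above it would be counted in [#|layer G 1|], although its
    [q_c] enters no function on [E_2]; the covering condition excludes this. *)
Lemma hilbert_series_algB :
    (forall c : V, c \in layer G 1 ->
      exists2 b : V, b \in layer G 2 & above b c) ->
  hilbert_series_eq (@grB G F)
     (1 + #|[set v : V | (0 < level v)%N]|%:Z *: 'X
        + (#|edges_from G 2|%:Z - 1) *: 'X^2
        + (#|edges_from G 2|%:Z - #|layer G 1|%:Z - #|layer G 2|%:Z + 1)
            *: 'X^3).
Proof.
move=> hcover.
have [eps [eps1 epsD epsZ epsM eps_gen]] := algB_augmentation G F.
have gM0 := @algB_gM0 G F; have gMsum0 := @algB_gMsum0 G F.
have g_syz := @algB_syzygy G F.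
have edge_above c : bottom e topv c -> exists2 b, e topv b & e b c.
  rewrite posVertex_bottom => lc; have [|b] := hcover (val c); first by rewrite inE.
  rewrite inE => lb bc; have pb : (0 < level b)%N by rewrite (eqP lb).
  exists (Sub b pb); rewrite /e ?adj_top //=.
  by apply: above_adj bc; rewrite (eqP lb) (eqP lc).
have c1 : #|bottom e topv| = #|layer G 1|.
  rewrite -card_pos_layer //; apply: eq_card => v.
  by rewrite [in RHS]inE -posVertex_bottom.
have c2 : #|e topv| = #|layer G 2|.
  rewrite -card_pos_layer //; apply: eq_card => v.
  by rewrite [in RHS]inE -adj_top.
have cX : #|{: X}| = #|[set v : V | (0 < level v)%N]|.
  by rewrite card_sig cardsE.
pose ind := @presAlg_ind _ _ (B_relations G F).
have d0 := has_dim_comp0 (pgen (B_relations G F)) eps1 epsZ.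
have d1 := has_dim_comp1 eps1 epsD epsZ epsM eps_gen g_syz.
have [n2 n2E d2] := has_dim_comp2 posVertex_no_edge_to_top posVertex_edge_from
  eps1 epsD epsZ epsM eps_gen gM0 gMsum0 g_syz posVertex_edge_below.
have [n3 n3E d3] := has_dim_comp3 posVertex_no_edge_to_top posVertex_edge_to_second posVertex_edge_from
  ind eps1 epsD epsZ epsM eps_gen gM0 gMsum0 g_syz posVertex_edge_below edge_above
  (posVertex_connected 0).
have d4 := has_dim_comp_ge4 posVertex_no_edge_to_top posVertex_edge_to_second posVertex_edge_from gM0.
move: n2E n3E; rewrite c1 c2 card_second_edges => n2E n3E.
case=> [|[|[|[|n]]]].
- exists 1%N; [exact: d0|]; rewrite !coefE /=; lia.
- exists #|{: X}|; [exact: d1|]; rewrite !coefE /= cX; lia.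
- exists n2; [exact: d2|]; rewrite !coefE /=; lia.
- exists n3; [exact: d3|]; rewrite !coefE /=; lia.
- exists 0%N; [exact: d4|]; rewrite !coefE /=; lia.
Qed.

End LayeredGraph.

(** * Resolution over A(Gamma) *)

Section EdgeAlgebra.
Variables (F : fieldType) (X : finType) (e : rel X) (a : X).
Hypothesis no_edge_to_top : forall u, ~~ e u a.
Hypothesis edge_to_second : forall u b, e a b -> e u b -> u = a.
Variables (A : algType F) (gr : nat -> A -> Prop) (g : X -> A).

Let path3 (p : X * X) := e a p.1 && e p.1 p.2.
(* The coefficient of t in P_a(t), computed along a -> p.1 -> p.2. *)
Let quad (p : X * X) := (g a - g p.1) * g p.1 + (g p.1 - g p.2) * g p.2.

Hypothesis gr_lin : forall c : X -> F, gr 1%N (\sum_v c v *: g v).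
Hypothesis augP : forall x, augmentation_ideal gr x <->
  exists y : X -> A, x = \sum_v y v * g v.
Hypothesis quad_eq : forall p p', path3 p -> path3 p' -> quad p = quad p'.
Hypothesis syz : forall x : X -> A, \sum_v x v * g v = 0 ->
  exists u : X * X -> A, [/\ forall p, ~~ path3 p -> u p = 0, \sum_p u p = 0
    & forall v, x v = (\sum_c u (v, c)) * (g a - g v)
                      + \sum_b u (b, v) * (g b - g v)].

Variable p0 : X * X.
Hypothesis path_p0 : path3 p0.

Lemma path3_second b c : path3 (b, c) -> ~~ e a c.
Proof.
move=> /andP[/= ab bc]; apply/negP => ac.
have eba := edge_to_second ac bc; have := no_edge_to_top a.
by rewrite -{2}eba ab.
Qed.

Lemma path3_notop v : ~~ path3 (a, v).
Proof. by rewrite /path3 /= (negPf (no_edge_to_top a)). Qed.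

(* By [syz] the coefficient of [a] vanishes in every syzygy, such as [w * a - w * b]. *)
Lemma subtop_reg b w : e a b -> w * (g a - g b) = 0 -> w = 0.
Proof.
move=> ab w0; have ba : b != a.
  by apply/eqP => eba; have := no_edge_to_top a; rewrite -{2}eba ab.
have [|u [u0 _ xE]] := syz (x := fun v => if v == a then w else if v == b then - w else 0).
  rewrite (bigD1 a) //= eqxx (bigD1 b) //= (negPf ba) eqxx big1 ?addr0.
    by rewrite mulNr -mulrBr.
  by move=> v /andP[/negPf-> /negPf->]; rewrite mul0r.
have := xE a; rewrite eqxx => ->.
rewrite big1 ?mul0r ?add0r => [|c _]; last by rewrite u0 // path3_notop.
rewrite big1 // => c _; rewrite u0 ?mul0r // /path3 /=.
by rewrite (negPf (no_edge_to_top _)) andbF.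
Qed.

(** The last-letter derivative of [quad p] at [v]. *)
Definition rho (p : X * X) (v : X) : A :=
  (v == p.1)%:R * (g a - g p.1) + (v == p.2)%:R * (g p.1 - g p.2).

Lemma sum_rho (u : X * X -> A) v :
  \sum_p u p * rho p v =
  (\sum_c u (v, c)) * (g a - g v) + \sum_b u (b, v) * (g b - g v).
Proof.
under eq_bigr do rewrite /rho mulrDr.
rewrite big_split; congr (_ + _).
  transitivity (\sum_b \sum_c u (b, c) * ((v == b)%:R * (g a - g b))).
    by rewrite pair_bigA; apply: eq_bigr => -[].
  rewrite (bigD1 v) //= [X in _ + X]big1 => [|b /negPf vb]; last first.
    by rewrite big1 // => c _; rewrite eq_sym vb mul0r mulr0.
  by rewrite addr0 mulr_suml; apply: eq_bigr => c _; rewrite eqxx mul1r.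
transitivity (\sum_b \sum_c u (b, c) * ((v == c)%:R * (g b - g c))).
  by rewrite pair_bigA; apply: eq_bigr => -[].
apply: eq_bigr => b _; rewrite (bigD1 v) //= eqxx mul1r big1 ?addr0 // => c /negPf vc.
by rewrite eq_sym vc mul0r mulr0.
Qed.

Lemma rho_gen p : \sum_v rho p v * g v = quad p.
Proof.
under eq_bigr do rewrite /rho mulrDl.
rewrite big_split /=; congr (_ + _).
  rewrite (bigD1 p.1) //= eqxx mul1r big1 ?addr0 // => v /negPf->.
  by rewrite !mul0r.
rewrite (bigD1 p.2) //= eqxx mul1r big1 ?addr0 // => v /negPf->.
by rewrite !mul0r.
Qed.

(** The quadratic relations are generated by the differences [quad p - quad p0], one fewer than the
    paths; hence the rank [|E_2| - 1]. *)
Let I2 := {p in [pred p | path3 p && (p != p0)]}.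

(** As [u] has zero sum, subtracting [f p0] changes nothing, and the term at [p0] then vanishes.
    This passes between families on all paths and families on [I2]. *)
Lemma sum_I2 (u : X * X -> A) (f : X * X -> A) :
    (forall p, ~~ path3 p -> u p = 0) -> \sum_p u p = 0 ->
  \sum_(p : I2) u (val p) * (f (val p) - f p0) = \sum_p u p * f p.
Proof.
move=> u0 us.
transitivity (\sum_p u p * (f p - f p0)).
  rewrite -(big_sub [pred p | path3 p && (p != p0)] (fun p => u p * (f p - f p0))).
  rewrite big_mkcond; apply: eq_bigr => p _; rewrite inE /=.
  have [_|/u0->] := boolP (path3 p); last by rewrite mul0r.
  by case: eqP => [->|//]; rewrite subrr mulr0.
under eq_bigr do rewrite mulrBr.
by rewrite sumrB -mulr_suml us mul0r subr0.
Qed.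

(** The equations of the space Z: the first block of columns confines the support to paths, the
    other two give the sums at vertices of level two and of level one. *)
Let M (p : X * X) (j : X * X + (X + X)) : F := match j with
  | inl p' => ((p == p') && ~~ path3 p)%:R
  | inr (inl b) => (p.1 == b)%:R
  | inr (inr c) => (p.2 == c)%:R end.

Lemma cycleP (V : lmodType F) (x : X * X -> V) :
  (forall j, \sum_p M p j *: x p = 0) <->
  [/\ forall p, ~~ path3 p -> x p = 0, forall b, \sum_c x (b, c) = 0
    & forall c, \sum_b x (b, c) = 0].
Proof.
have sl p : \sum_p' M p' (inl p) *: x p' = if path3 p then 0 else x p.
  rewrite (bigD1 p) //= eqxx big1 => [|p' /negPf->]; last by rewrite scale0r.
  by case: (path3 p); rewrite ?scale0r ?scale1r ?addr0.
have sb b : \sum_p M p (inr (inl b)) *: x p = \sum_c x (b, c).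
  transitivity (\sum_b' \sum_c M (b', c) (inr (inl b)) *: x (b', c)).
    by rewrite pair_bigA; apply: eq_bigr => -[].
  rewrite (bigD1 b) //= [X in _ + X]big1 => [|b' /negPf bb]; last first.
    by rewrite big1 // => c _; rewrite bb scale0r.
  by rewrite addr0; apply: eq_bigr => c _; rewrite eqxx scale1r.
have sc c : \sum_p M p (inr (inr c)) *: x p = \sum_b x (b, c).
  transitivity (\sum_b \sum_c' M (b, c') (inr (inr c)) *: x (b, c')).
    by rewrite pair_bigA; apply: eq_bigr => -[].
  apply: eq_bigr => b _; rewrite (bigD1 c) //= eqxx scale1r big1 ?addr0 // => c' /negPf->.
  by rewrite scale0r.
split=> [h|[h1 h2 h3] [p|[b|c]]].
- split=> [p hp|b|c]; [|by rewrite -sb|by rewrite -sc].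
  by have := h (inl p); rewrite sl (negPf hp).
- by rewrite sl; case: ifP => // /negbT/h1.
- by rewrite sb.
- by rewrite sc.
Qed.

(** * Exactness of the complex over A *)

Section Resolution.
Variables (k : nat) (K : 'I_k -> X * X -> F).
Hypothesis Kker : forall l j, \sum_p K l p * M p j = 0.
Hypothesis Kspan : forall (V : lmodType F) (x : X * X -> V),
  (forall j, \sum_p M p j *: x p = 0) ->
  exists y : 'I_k -> V, forall p, x p = \sum_l K l p *: y l.
Hypothesis Kfree : forall (V : lmodType F) (y : 'I_k -> V),
  (forall p, \sum_l K l p *: y l = 0) -> forall l, y l = 0.

Let Kcyc l : [/\ forall p, ~~ path3 p -> K l p = 0, forall b, \sum_c K l (b, c) = 0
    & forall c, \sum_b K l (b, c) = 0].
Proof.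
apply/(@cycleP F^o (K l)) => j; rewrite -[RHS](Kker l j).
by apply: eq_bigr => p _; rewrite mulrC.
Qed.

Lemma syzygies_generators (x : X -> A) : \sum_v x v * g v = 0 <->
  exists y : I2 -> A, forall v, x v = \sum_p y p * (rho (val p) v - rho p0 v).
Proof.
split=> [/syz[u [u0 us xE]]|[y xE]].
  exists (fun p => u (val p)) => v.
  by rewrite (@sum_I2 _ (fun p => rho p v)) // sum_rho.
under eq_bigr do rewrite xE mulr_suml.
rewrite exchange_big big1 //= => p _.
under eq_bigr do rewrite -mulrA mulrBl.
rewrite -mulr_sumr sumrB !rho_gen (quad_eq _ path_p0) ?subrr ?mulr0 //.
by have := valP p; rewrite inE => /andP[].
Qed.

Lemma sum_cycle_rho (x : X * X -> F) v :
    [/\ forall p, ~~ path3 p -> x p = 0, forall b, \sum_c x (b, c) = 0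
      & forall c, \sum_b x (b, c) = 0] ->
  \sum_p x p *: (g a - g p.1) * rho p v = 0.
Proof.
case=> x0 xr xc; rewrite sum_rho /=.
rewrite -scaler_suml xr scale0r mul0r add0r.
(* On a path a b v one has [(a - b)(b - v) = quad (b, v) + v v - a v], which does not depend on
   [b]. *)
transitivity ((\sum_b x (b, v)) *: (quad p0 + g v * g v - g a * g v)); last first.
  by rewrite xc scale0r.
rewrite scaler_suml; apply: eq_bigr => b _; rewrite -scalerAl.
have [pv|/x0->] := boolP (path3 (b, v)); last by rewrite !scale0r.
congr (_ *: _); rewrite (quad_eq path_p0 pv) /quad /=.
rewrite mulrBr mulrBl [(g a - g b) * g v]mulrBl.
rewrite [(g b - g v) * g v]mulrBl.
by rewrite opprB -!addrA; congr (_ + (_ + _)); rewrite addKr addrC.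
Qed.

(* For fixed [c], [syz] applies once more to the sum of the [u (b, c) * (b - c)]
   over [b]; its solution divides each [u (b, c)] by [a - b]. *)
Lemma syzygies_relations (y : I2 -> A) :
  (forall v, \sum_p y p * (rho (val p) v - rho p0 v) = 0) <->
  exists z : 'I_k -> A, forall p,
    y p = \sum_l z l * (K l (val p) *: (g a - g (val p).1)).
Proof.
split=> [yv|[z yE] v]; last first.
  under eq_bigr do rewrite yE mulr_suml.
  rewrite exchange_big big1 //= => l _.
  under eq_bigr do rewrite -mulrA.
  rewrite -mulr_sumr (_ : \sum_p _ = 0) ?mulr0 //.
  have [x0 xr xc] := Kcyc l.
  rewrite (@sum_I2 (fun p => K l p *: (g a - g p.1)) (fun p => rho p v)).
  - exact: sum_cycle_rho.
  - by move=> p /x0->; rewrite scale0r.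
  transitivity (\sum_b \sum_c K l (b, c) *: (g a - g b)).
    by rewrite pair_bigA; apply: eq_bigr => -[].
  by rewrite big1 // => b _; rewrite -scaler_suml xr scale0r.
(* The value at [p0] is chosen to make the total zero, as [sum_I2] requires. *)
pose u p := if p == p0 then - \sum_p' y p' else
  if insub p is Some p' then y p' else 0.
have uE (p : I2) : u (val p) = y p.
  by rewrite /u valK; have := valP p; rewrite inE => /andP[_ /negPf->].
have u0 p : ~~ path3 p -> u p = 0.
  move=> hp; rewrite /u; case: eqP => [ep|_]; first by move: hp; rewrite ep path_p0.
  by case: insubP => // p' /andP[]; rewrite (negPf hp).
have us : \sum_p u p = 0.
  rewrite (bigD1 p0) //= {1}/u eqxx addrC; apply/eqP; rewrite subr_eq0; apply/eqP.
  under [RHS]eq_bigr do rewrite -uE.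
  rewrite -(big_sub [pred p | path3 p && (p != p0)] u).
  rewrite big_mkcond [RHS]big_mkcond; apply: eq_bigr => p _; rewrite inE.
  have [//|/u0->] := boolP (path3 p).
  by rewrite if_same.
have uv v : (\sum_c u (v, c)) * (g a - g v) + \sum_b u (b, v) * (g b - g v) = 0.
  rewrite -sum_rho -(@sum_I2 _ (fun p => rho p v)) // -[RHS](yv v).
  by apply: eq_bigr => p _; rewrite uE.
(* No path ends in the second layer, so for [b] there [uv b] reduces to a multiple of [g a - g b],
   which [subtop_reg] cancels. *)
have ur b : \sum_c u (b, c) = 0.
  have [ab|nab] := boolP (e a b); last first.
    by rewrite big1 // => c _; rewrite u0 // /path3 /= (negPf nab).
  apply: (subtop_reg ab); rewrite -[RHS](uv b) [X in _ = _ + X]big1 ?addr0 // => b' _.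
  by rewrite u0 ?mul0r //; apply/negP => /path3_second; rewrite ab.
have uc c : \sum_b u (b, c) * (g b - g c) = 0.
  by rewrite -[RHS](uv c) ur mul0r add0r.
have /choice[W hW] (c : X) : exists u' : X * X -> A,
    [/\ forall p, ~~ path3 p -> u' p = 0, \sum_p u' p = 0
      & forall b, u (b, c) = (\sum_c' u' (b, c')) * (g a - g b)].
  (* Collecting the terms in [g c] turns [uc c] into a syzygy, with [- s] as correction at [c]. *)
  pose s := \sum_b u (b, c).
  have [|u' [u'0 u's xE]] := syz (x := fun v => u (v, c) - (if v == c then s else 0)).
    have sc : \sum_v (if v == c then s else 0) * g v = s * g c.
      rewrite (bigD1 c) //= eqxx [X in _ + X]big1 ?addr0 // => v /negPf->.
      by rewrite mul0r.
    under eq_bigr do rewrite mulrBl.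
    rewrite sumrB sc mulr_suml -sumrB -[RHS](uc c).
    by apply: eq_bigr => b _; rewrite mulrBr.
  exists u'; split=> // b; have [ab|nab] := boolP (e a b); last first.
    rewrite u0 ?big1 ?mul0r // => [c' _|]; last by rewrite /path3 /= (negPf nab).
    by rewrite u'0 // /path3 /= (negPf nab).
  have := xE b; rewrite [X in _ = _ + X]big1 => [|b' _]; last first.
    by rewrite u'0 ?mul0r //; apply/negP => /path3_second; rewrite ab.
  rewrite addr0 => <-; case: eqP => [ebc|_]; last by rewrite subr0.
  rewrite /s big1 ?subr0 // => b' _; rewrite u0 //.
  by apply/negP => /path3_second; rewrite -ebc ab.
pose x (p : X * X) := \sum_c' W p.2 (p.1, c').
have ux b c : u (b, c) = x (b, c) * (g a - g b) by have [_ _ ->] := hW c.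
(* The sums over [c] vanish by [ur] and cancellation of [g a - g b], those over [b] because [W c]
   has zero total. *)
have xcyc : [/\ forall p, ~~ path3 p -> x p = 0, forall b, \sum_c x (b, c) = 0
    & forall c, \sum_b x (b, c) = 0].
  have xab b c : ~~ e a b -> x (b, c) = 0.
    move=> nab; rewrite /x big1 // => c' _; have [W0 _ _] := hW c.
    by rewrite W0 // /path3 /= (negPf nab).
  split=> [[b c] hp|b|c].
  - have [ab|/xab//] := boolP (e a b).
    by apply: (subtop_reg ab); rewrite -ux u0.
  - have [ab|nab] := boolP (e a b); last by rewrite big1 // => c _; apply: xab.
    apply: (subtop_reg ab); rewrite mulr_suml -[RHS](ur b).
    by apply: eq_bigr => c _; rewrite ux.
  - have [_ Ws _] := hW c; rewrite -[RHS]Ws.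
    by rewrite pair_bigA; apply: eq_bigr => -[].
have [z xz] := Kspan ((cycleP x).2 xcyc).
exists z => p; rewrite -uE; case: (val p) => b c; rewrite ux xz mulr_suml.
by apply: eq_bigr => l _; rewrite -scalerAl scalerAr.
Qed.

(** Injectivity of the last map, which does not see the entry at [p0]. The other entries vanish by
    [subtop_reg], and that one because the entries along the edges out of [p0.1] sum to zero. The
    variable over [void] matches the shape of [koszul_fin]. *)
Lemma syzygies_cycles (z : 'I_k -> A) :
  (forall p : I2, \sum_l z l * (K l (val p) *: (g a - g (val p).1)) = 0) <->
  exists y : void -> A, forall l, z l = 0.
Proof.
split=> [zp|[_ z0] p]; last by rewrite big1 // => l _; rewrite z0 mul0r.
exists (fun=> 0); apply: Kfree => p.
pose x p := \sum_l K l p *: z l.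
have x0 p' : ~~ path3 p' -> x p' = 0.
  move=> hp; rewrite /x big1 // => l _.
  by have [-> //] := Kcyc l; rewrite scale0r.
have x1 p' : p' != p0 -> x p' = 0.
  move=> hp; have [pp|/x0//] := boolP (path3 p').
  have hI : p' \in [pred p | path3 p && (p != p0)] by rewrite inE pp.
  case/andP: (pp) => ab _; apply: (subtop_reg ab).
  rewrite -[RHS](zp (Sub p' hI)) /x mulr_suml; apply: eq_bigr => l _ /=.
  by rewrite -scalerAl scalerAr.
have [->|/x1//] := eqVneq p p0.
have xs : \sum_c x (p0.1, c) = 0.
  rewrite exchange_big big1 //= => l _.
  by have [_ xr _] := Kcyc l; rewrite -scaler_suml xr scale0r.
rewrite -[LHS]/(x p0) -[RHS]xs (bigD1 p0.2) //= -surjective_pairing.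
rewrite big1 ?addr0 // => c hc; apply: x1.
by apply: contra hc => /eqP<-.
Qed.

End Resolution.

Section Koszulness.
Variables (k : nat) (K : 'I_k -> X * X -> F).

Definition res_index n : finType := match n with
  | 0 => unit | 1 => X | 2 => I2 | 3 => 'I_k | _ => void end%N.

Definition res_diff n : res_index n.+1 -> res_index n -> A :=
  match n return res_index n.+1 -> res_index n -> A with
  | 0%N => fun v _ => g v
  | 1%N => fun p v => rho (val p) v - rho p0 v
  | 2%N => fun l p => K l (val p) *: (g a - g (val p).1)
  | _ => fun x _ => match x with end end.
End Koszulness.

Lemma koszul_edgeAlgebra : koszul gr.
Proof.
have [k [K [Kker Kspan Kfree]]] := kernel_basis M.
pose lin1 x := exists c : X -> F, x = \sum_u c u *: g u.
have lin_gr x : lin1 x -> gr 1%N x by case=> c ->; apply: gr_lin.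
have linB x y : lin1 x -> lin1 y -> lin1 (x - y).
  move=> [c ->] [c' ->]; exists (fun u => c u - c' u).
  by rewrite -sumrB; apply: eq_bigr => u _; rewrite scalerBl.
have linZ t x : lin1 x -> lin1 (t *: x).
  move=> [c ->]; exists (fun u => t * c u).
  by rewrite scaler_sumr; apply: eq_bigr => u _; rewrite scalerA.
have ling v : lin1 (g v).
  exists (fun u => (u == v)%:R); rewrite (bigD1 v) //= eqxx scale1r.
  by rewrite big1 ?addr0 // => u /negPf->; rewrite scale0r.
have linN x : lin1 x -> lin1 (- x) by rewrite -scaleN1r; apply: linZ.
have linD x y : lin1 x -> lin1 y -> lin1 (x + y).
  by move=> hx hy; rewrite -[y]opprK; apply/linB/linN.
have linn (b : bool) x : lin1 x -> lin1 (b%:R * x).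
  by case: b => hx; rewrite ?mul1r // mul0r -(scale0r x); apply: linZ.
apply: (@koszul_fin F A gr (res_index k) (res_diff K)).
- by rewrite card_unit.
- move=> [|[|[|i]]] /= x y; apply: lin_gr.
  + exact: ling.
  + by rewrite /rho; apply: (linB); apply: linD; apply/linn/linB.
  + exact/linZ/linB.
  + by case: x.
- move=> x; split=> [/(_ tt)/augP[y xE]|[y xE] j].
    by exists y => -[].
  by apply/augP; exists y; rewrite xE.
case=> [|[|[|[|i]]]] x /=.
- by rewrite -(syzygies_generators x); split=> [/(_ tt)//|h []].
- exact: syzygies_relations.
- rewrite (syzygies_cycles Kker Kfree); split=> [[y z0]|[y z0]]; exists y => l.
    by rewrite z0 big1 // => -[].
  by rewrite z0 big1 // => -[].
- by split=> [_|_ j]; [exists (fun=> 0) => -[] | rewrite big1 // => -[]].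
- by split=> [_|_ []]; exists (fun=> 0) => -[].
Qed.

End EdgeAlgebra.

(** * Vertex presentation of A(Gamma) *)

Lemma eq_XsubC_mul (R : nzRingType) (x y x' y' : R) :
  x + y = x' + y' -> x * y = x' * y' ->
  ('X - x%:P) * ('X - y%:P) = ('X - x'%:P) * ('X - y'%:P).
Proof.
have expand (u v : R) : ('X - u%:P) * ('X - v%:P) = 'X * 'X - (u + v)%:P * 'X + (u * v)%:P.
  rewrite mulrBl !mulrBr -[in 'X * v%:P]commr_polyX polyCD polyCM mulrDl opprB opprD.
  by rewrite -!addrA; congr (_ + _); rewrite [RHS]addrC -addrA addrCA addrC -addrA addrCA.
by move=> es ep; rewrite !expand es ep.
Qed.

(** * Polynomials attached to vertices *)

Section PathPolynomials.
Variables (G : layeredGraph) (R : nzRingType).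
Local Notation V := (vertex G).
Local Notation E := (edge G).

Lemma prod_XsubC_monic (h : E -> R) (p : seq E) : \prod_(e <- p) ('X - (h e)%:P) \is monic.
Proof. by rewrite monic_prod // => e _; apply: monicXsubC. Qed.

(** Either product times [Q] at the common head is [Q] at the common tail, and a monic factor
    cancels on the right even over a noncommutative ring. *)
Lemma path_poly_unique (h : E -> R) (Q : V -> {poly R}) :
    (forall v, Q v \is monic) ->
    (forall e, Q (etail e) = ('X - (h e)%:P) * Q (ehead e)) ->
  forall (e f : E) (p q : seq E), dipath e p -> dipath f q -> etail e = etail f ->
    ehead (last e p) = ehead (last f q) ->
  \prod_(x <- e :: p) ('X - (h x)%:P) =
  \prod_(x <- f :: q) ('X - (h x)%:P).
Proof.
move=> Qmonic QE; have pathE (p : seq E) (e : E) : dipath e p ->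
    \prod_(x <- e :: p) ('X - (h x)%:P) * Q (ehead (last e p))
    = Q (etail e).
  elim: p e => [|e' p IHp] e /=; first by rewrite big_seq1 -QE.
  rewrite /dipath /= => /andP[/eqP ee' pp].
  by rewrite big_cons -mulrA IHp // -ee' -QE.
move=> e f p q ep fq eft efh; apply: (monic_rreg (Qmonic (ehead (last e p)))).
by rewrite pathE // efh pathE // eft.
Qed.

Section Vertices.
Variables (a : V) (g : V -> R).
Hypothesis level_le3 : forall v : V, (level v <= 3)%N.
Hypothesis level_top : forall v : V, (level v == 3) = (v == a).
Hypothesis adj_top : forall b : V, adj a b = (level b == 2).
Hypothesis out_edge : forall v : V, (0 < level v)%N -> exists w, adj v w.
Hypothesis second_layer_connected : forall f : V -> {poly R},
    (forall b b' c : V, level b = 2 -> adj b c -> adj b' c -> f b = f b') ->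
  forall b b' : V, level b = 2 -> level b' = 2 -> f b = f b'.
Hypothesis g0 : forall v, level v = 0%N -> g v = 0.
Hypothesis quad_eq : forall b c b' c' : V,
  adj a b -> adj b c -> adj a b' -> adj b' c' ->
  (g a - g b) * g b + (g b - g c) * g c = (g a - g b') * g b' + (g b' - g c') * g c'.

(* [Q v] is P_v(t); connectivity of the second layer for polynomial-valued
   functions turns the quadratic relations into the cubic ones. *)
Lemma vertex_poly_exists : exists Q : V -> {poly R}, (forall v, Q v \is monic) /\
  (forall e, Q (etail e) = ('X - (g (etail e) - g (ehead e))%:P) * Q (ehead e)).
Proof.
(* [s v] is a chosen vertex below [v]; at level zero [v] itself is a mere default. *)
have /choice[s hs] (v : V) : exists w, (0 < level v)%N -> adj v w.
  have [/out_edge[w vw]|_] := boolP (0 < level v)%N; first by exists w.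
  by exists v.
pose Q1 (v : V) : {poly R} := 'X - (g v)%:P.
pose Q2 v : {poly R} := ('X - (g v - g (s v))%:P) * Q1 (s v).
pose Q3 v : {poly R} := ('X - (g v - g (s v))%:P) * Q2 (s v).
pose Q v : {poly R} := match level v with 0%N => 1 | 1%N => Q1 v | 2%N => Q2 v | _ => Q3 v end.
have Q1m v : Q1 v \is monic by apply: monicXsubC.
have Q2m v : Q2 v \is monic by rewrite monicMl // monicXsubC.
have Q3m v : Q3 v \is monic by rewrite monicMl // monicXsubC.
have Qm v : Q v \is monic.
  by rewrite /Q; case: (level v) => [|[|[|]]] //; apply: monic1.
(* Two paths through the same [b] have equal quadratic coefficients, and the common term
   [(g a - g b) * g b] cancels. *)
have Q2E (b c : V) : level b = 2 -> adj b c -> Q2 b = ('X - (g b - g c)%:P) * Q1 c.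
  move=> lb bc; have ab : adj a b by rewrite adj_top lb.
  apply: eq_XsubC_mul; first by rewrite !subrK.
  have bs : adj b (s b) by apply: hs; rewrite lb.
  by have := quad_eq ab bs ab bc; apply: addrI.
(* P_a computed through [b] is a function of [b]. If [b] and [b'] have a common [c] below, the
   factor [Q1 c] splits off on the right, and the remaining two linear factors are compared by their
   sum and product. *)
have Q3E (b : V) : level b = 2 -> Q3 a = ('X - (g a - g b)%:P) * Q2 b.
  move=> lb; have la : level a = 3 by apply/eqP; rewrite level_top.
  have lsa : level (s a) = 2 by apply/eqP; rewrite -adj_top hs // la.
  rewrite /Q3; apply: (second_layer_connected (f := fun b => ('X - (g a - g b)%:P) * Q2 b))
    lsa lb => {}b b' c lb bc b'c.
  have lb' : level b' = 2 by rewrite (adj_level b'c) -(adj_level bc).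
  rewrite (Q2E b c) // (Q2E b' c) // !mulrA; congr (_ * _).
  have ab : adj a b by rewrite adj_top lb.
  have ab' : adj a b' by rewrite adj_top lb'.
  apply: eq_XsubC_mul; first by rewrite !addrA !subrK.
  have key b1 : (g a - g b1) * (g b1 - g c) =
      (g a - g b1) * g b1 + (g b1 - g c) * g c + (g c * g c - g a * g c).
    rewrite mulrBr [(g a - g b1) * g c]mulrBl [(g b1 - g c) * g c]mulrBl.
    by rewrite -addrA; congr (_ + _); rewrite opprB addrA subrK.
  by rewrite !key (quad_eq ab bc ab' b'c).
exists Q; split=> // e; have := level_etail e; rewrite /Q.
have le3 := level_le3 (etail e).
have te : adj (etail e) (ehead e) by apply/adjP; exists e.
case lh: (level (ehead e)) => [|[|[|n]]] lt; rewrite lt.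
- by rewrite mulr1 /Q1 (g0 lh) subr0.
- exact: Q2E.
- have /eqP ea : etail e == a by rewrite -level_top lt.
  by rewrite ea; apply: Q3E.
- by move: le3; rewrite lt.
Qed.

End Vertices.

(** * Vertex elements constructed from the edges *)

Section Edges.
Variables (a s : V) (h : E -> R).
Hypothesis level_a : level a = 3.
Hypothesis level_bottom : forall v : V, (level v == 0%N) = (v == s).
Hypothesis out_edge : forall v : V, (0 < level v)%N -> exists w, adj v w.
Hypothesis h_path : forall (e f : E) (p q : seq E),
  dipath e p -> dipath f q -> size p = size q -> etail e = etail f ->
  ehead (last e p) = ehead (last f q) ->
  \prod_(x <- e :: p) ('X - (h x)%:P) = \prod_(x <- f :: q) ('X - (h x)%:P).

(** Paths from [v] down to the minimal vertex [s], including the empty path, which [dipath] does not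
    cover. *)
Fixpoint epath (v : V) (p : seq E) : bool :=
  if p is e :: p' then (etail e == v) && epath (ehead e) p' else v == s.

Lemma epath_size v p : epath v p -> size p = level v.
Proof.
elim: p v => [|e p IHp] v /=; first by rewrite -level_bottom => /eqP.
by case/andP=> /eqP <- /IHp->; rewrite level_etail.
Qed.

Lemma epath_cons v e p : epath v (e :: p) ->
  [/\ etail e = v, dipath e p & ehead (last e p) = s].
Proof.
elim: p v e => [|f p IHp] v e /=; first by case/andP=> /eqP-> /eqP->.
case/andP=> /eqP ev /andP[/eqP ef fp].
have [|_ dp lp] := IHp (ehead e) f; first by rewrite /= ef eqxx fp.
by split=> //; rewrite /dipath /= ef eqxx.
Qed.

Lemma epath_poly v p q : epath v p -> epath v q ->
  \prod_(x <- p) ('X - (h x)%:P) = \prod_(x <- q) ('X - (h x)%:P).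
Proof.
move=> vp vq; have := epath_size vp; rewrite -(epath_size vq).
case: p q vp vq => [|e p] [|f q] // /epath_cons[te de le] /epath_cons[tf df lf] [spq].
by apply: h_path => //; [rewrite te tf | rewrite le lf].
Qed.

Lemma epath_exists v : exists p, epath v p.
Proof.
move: {2}(level v) (erefl (level v)) => n; elim: n v => [|n IHn] v lv.
  by exists [::]; rewrite /= -level_bottom lv.
have [|w /adjP[e [ev ew]]] := out_edge (v := v); first by rewrite lv.
have [|p wp] := IHn w; first by have := level_etail e; rewrite ev ew lv => -[].
by exists (e :: p); rewrite /= ev ew eqxx.
Qed.

Lemma vertex_elements_exist : exists g : V -> R,
  [/\ forall v, level v = 0%N -> g v = 0, forall e, h e = g (etail e) - g (ehead e)
    & forall b c b' c' : V, adj a b -> adj b c -> adj a b' -> adj b' c' ->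
      (g a - g b) * g b + (g b - g c) * g c = (g a - g b') * g b' + (g b' - g c') * g c'].
Proof.
have /choice[P hP] := epath_exists.
pose Q v : {poly R} := \prod_(x <- P v) ('X - (h x)%:P).
(* Minus the subleading coefficient of [Q v], that is, the sum of the edges along a path from [v] to
   [s]; the factor ['X] shifts the index so that level zero gives 0. *)
pose g v := - ('X * Q v)`_(level v).
have QE e : Q (etail e) = ('X - (h e)%:P) * Q (ehead e).
  rewrite /Q -(big_cons _ _ _ _ xpredT (fun x => 'X - (h x)%:P)).
  by apply: epath_poly (hP _) _; rewrite /= eqxx hP.
have sQ v : size (Q v) = (level v).+1 by rewrite size_prod_XsubC (epath_size (hP v)).
have Q1 v : (Q v)`_(level v) = 1.
  by have /monicP := prod_XsubC_monic h (P v); rewrite lead_coefE -/(Q v) sQ.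
have gE e : h e = g (etail e) - g (ehead e).
  rewrite /g level_etail coefXM /= QE mulrBl coefB coefCM Q1 mulr1.
  by rewrite opprB opprK addrC addrCA subrr addr0.
have g0 v : level v = 0%N -> g v = 0.
  by move=> lv; rewrite /g lv coefXM oppr0.
exists g; split=> //.
(* Continued by an edge from [c] to level zero, every path a b c yields the factorisation
   [(t - (a - b))(t - (b - c))(t - c)] of the same [Q a]. *)
have quadE (b c : V) : adj a b -> adj b c ->
    (g a - g b) * g b + (g b - g c) * g c = (Q a)`_1.
  case/adjP=> e1 [t1 h1] /adjP[e2 [t2 h2]].
  have lb : level b = 2 by have := level_etail e1; rewrite t1 h1 level_a => -[].
  have lc : level c = 1%N by have := level_etail e2; rewrite t2 h2 lb => -[].
  have [|w /adjP[e3 [t3 h3]]] := out_edge (v := c); first by rewrite lc.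
  have lw : level w = 0%N by have := level_etail e3; rewrite t3 h3 lc => -[].
  have gw := g0 w lw; have Qw : Q w = 1.
    by apply/eqP; have := sQ w; rewrite /Q lw size_prod_XsubC => -[/size0nil ->]; rewrite big_nil.
  have Qc : Q c = 'X - (g c)%:P by rewrite -t3 QE h3 Qw mulr1 gE h3 gw subr0.
  have Qb : Q b = ('X - (g b - g c)%:P) * Q c by rewrite -t2 QE h2 gE t2 h2.
  have -> : Q a = ('X - (g a - g b)%:P) * (('X - (g b - g c)%:P) * ('X - (g c)%:P)).
    by rewrite -Qc -Qb -t1 QE h1 gE t1 h1.
  have coef1 (x y z : R) :
      (('X - x%:P) * (('X - y%:P) * ('X - z%:P)))`_1 = x * (y + z) + y * z.
    have c0 : (('X - y%:P) * ('X - z%:P))`_0 = y * z.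
      by rewrite mulrBl coefB coefXM coefCM coefB coefX coefC /= !sub0r mulrN opprK.
    have c1 : (('X - y%:P) * ('X - z%:P))`_1 = - (y + z).
      rewrite mulrBl coefB coefXM coefCM !coefB !coefX !coefC /= sub0r subr0 mulr1.
      by rewrite opprD addrC.
    by rewrite mulrBl coefB coefXM coefCM /= c0 c1 mulrN opprK addrC.
  by rewrite coef1 subrK.
by move=> b c b' c' ab bc ab' bc'; rewrite !quadE.
Qed.

End Edges.
End PathPolynomials.

Lemma map_prod_XsubC (R S : nzRingType) (phi : {rmorphism R -> S}) (I : Type)
    (f : I -> R) (p : seq I) :
  map_poly phi (\prod_(x <- p) ('X - (f x)%:P)) = \prod_(x <- p) ('X - (phi (f x))%:P).
Proof.
rewrite rmorph_prod; apply: eq_bigr => x _.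
by rewrite rmorphB /= map_polyX (map_polyC phi).
Qed.

Lemma rmorph_quad (R S : nzRingType) (phi : {rmorphism R -> S}) (x y z : R) :
  phi ((x - y) * y + (y - z) * z) =
  (phi x - phi y) * phi y + (phi y - phi z) * phi z.
Proof. by rewrite rmorphD !rmorphM !rmorphB. Qed.

(** * Presentation by vertices and the map from A *)

Section VertexPresentation.
Variables (F : fieldType) (G : layeredGraph) (a : vertex G).
Local Notation V := (vertex G).
Local Notation E := (edge G).

Lemma map_path_poly (S : nzRingType) (phi : {rmorphism freeAlg F E -> S}) (p : seq E) :
  map_poly phi (path_poly F p) = \prod_(x <- p) ('X - (phi (fgen F x))%:P).
Proof.
exact: map_prod_XsubC.
Qed.

Lemma A_rel_hom0 (S : nzRingType) (phi : {rmorphism freeAlg F E -> S}) :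
    (forall (e f : E) (p q : seq E), dipath e p -> dipath f q -> etail e = etail f ->
       ehead (last e p) = ehead (last f q) ->
       \prod_(x <- e :: p) ('X - (phi (fgen F x))%:P) =
       \prod_(x <- f :: q) ('X - (phi (fgen F x))%:P)) ->
  forall r, A_is_rel r -> phi r = 0.
Proof.
move=> hphi r [e [f [p [q [i [[ep fq _ eft efh] ->]]]]]].
have coefE s : phi (path_poly F s)`_i = (\prod_(x <- s) ('X - (phi (fgen F x))%:P))`_i.
  by rewrite -map_path_poly (coef_map phi).
by rewrite rmorphB !coefE (hphi e f p q) // subrr.
Qed.

Definition quad_rel (b c : V) : freeAlg F V :=
  (fgen F a - fgen F b) * fgen F b + (fgen F b - fgen F c) * fgen F c.

(** Vertices of level zero stay generators and are set to 0, so that every edge is tail minus head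
    without exception. With [b = b'] the quadratic relations include those between paths out of
    [b]. *)
Definition vertex_is_rel (r : freeAlg F V) : Prop :=
  (exists v, level v = 0%N /\ r = fgen F v)
  \/ (exists b c b' c' : V, [/\ adj a b, adj b c, adj a b' & adj b' c']
       /\ r = quad_rel b c - quad_rel b' c').

Fact vertex_is_rel_aug r : vertex_is_rel r -> r@_mone = 0.
Proof.
have augB x y : free_aug (x - y : freeAlg F V) = free_aug x - free_aug y.
  exact: mcoeffB.
have quad0 b c : free_aug (quad_rel b c) = 0.
  have aug_last (x : freeAlg F V) (v : V) : free_aug (x * fgen F v) = 0.
    by rewrite free_augM free_aug_fgen mulr0.
  apply: etrans (free_augD _ _) _.
  exact: (etrans (congr2 +%R (aug_last _ _) (aug_last _ _)) (addr0 0)).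
case=> [[v [_ ->]]|[b [c [b' [c' [_ ->]]]]]]; first exact: free_aug_fgen.
apply: etrans (augB _ _) _.
exact: (etrans (congr2 (fun x y => x - y) (quad0 _ _) (quad0 _ _)) (subrr 0)).
Qed.

Definition vertex_relations := Relations vertex_is_rel_aug.
Local Notation A' := (presAlg vertex_relations).
Local Notation gv := (pgen vertex_relations).

Lemma vertex_gen0 v : level v = 0%N -> gv v = 0.
Proof. by move=> lv; apply: pres_rel; left; exists v. Qed.

Lemma vertex_quad_eq (b c b' c' : V) :
  adj a b -> adj b c -> adj a b' -> adj b' c' ->
  (gv a - gv b) * gv b + (gv b - gv c) * gv c =
  (gv a - gv b') * gv b' + (gv b' - gv c') * gv c'.
Proof.
move=> ab bc ab' bc'.
have quadE u v : (gv a - gv u) * gv u + (gv u - gv v) * gv v =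
    pres_pi vertex_relations (quad_rel u v).
  exact: (esym (rmorph_quad (pres_pi vertex_relations) _ _ _)).
apply: (etrans (quadE _ _)); apply: (etrans _ (esym (quadE _ _))).
by apply: pres_rel_eq; right; exists b, c, b', c'.
Qed.

Lemma fox_quad_rel (b c v : V) : fox vertex_relations v (quad_rel b c) =
  (v == b)%:R * (gv a - gv b) + (v == c)%:R * (gv b - gv c).
Proof.
have piB u w : pres_pi vertex_relations (fgen F u - fgen F w) = gv u - gv w.
  exact: rmorphB.
rewrite -(piB a b) -(piB b c) -(fox_mul_gen _ _ _ b) -(fox_mul_gen _ _ _ c).
exact: foxD.
Qed.

Hypothesis hunif : uniform G.
Hypothesis hlevel : forall v : V, (level v <= 3)%N.
Hypothesis hmin : exists! v : V, minimal v.
Hypothesis hmin0 : forall v : V, minimal v -> v \in layer G 0.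
Hypothesis htop : layer G 3 = [set a].
Hypothesis habove : forall b : V, b \in layer G 2 -> above a b.

Local Notation A := (algA G F).
Local Notation ge := (pgen (A_relations G F)).

Lemma in_alg_central (R : algType F) (c : F) (x : R) : in_alg R c * x = x * in_alg R c.
Proof. by rewrite /= -scalerAl mul1r -scalerAr mulr1. Qed.

Lemma algA_to_vertex : exists theta : {rmorphism A -> A'},
  (forall e, theta (ge e) = gv (etail e) - gv (ehead e))
  /\ (forall c x, theta (c *: x) = in_alg A' c * theta x).
Proof.
apply: presAlg_hom; first exact: in_alg_central.
move=> phi phig r; apply: A_rel_hom0 => e f p q ep fq eft efh.
have [Q [Qm QE]] := vertex_poly_exists hlevel (level_top htop) (adj_top htop habove)
  (out_edge hmin0) (second_layer_connected hunif htop habove (T := {poly A'}))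
  vertex_gen0 vertex_quad_eq.
apply: (path_poly_unique Qm _ ep fq eft efh) => x.
by rewrite phig QE.
Qed.

Lemma algA_h_path (e f : E) (p q : seq E) :
  dipath e p -> dipath f q -> size p = size q -> etail e = etail f ->
  ehead (last e p) = ehead (last f q) ->
  \prod_(x <- e :: p) ('X - (ge x)%:P) = \prod_(x <- f :: q) ('X - (ge x)%:P).
Proof.
move=> ep fq spq eft efh.
have polE s := map_path_poly (pres_pi (A_relations G F)) s.
apply: etrans (esym (polE (e :: p))) (etrans _ (polE (f :: q))).
apply/polyP => i; rewrite !(coef_map (pres_pi (A_relations G F))).
by apply: pres_rel_eq; exists e, f, p, q, i.
Qed.

End VertexPresentation.

Lemma sum_delta (R : nzRingType) (I : finType) (i : I) (f : I -> R) :
  \sum_j (j == i)%:R * f j = f i.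
Proof.
rewrite (bigD1 i) //= eqxx mul1r big1 ?addr0 // => j /negPf->.
by rewrite mul0r.
Qed.

Lemma sum_delta_sub (R : nzRingType) (I : finType) (i i' : I) (f : I -> R) :
  \sum_j ((j == i)%:R - (j == i')%:R) * f j = f i - f i'.
Proof. by under eq_bigr do rewrite mulrBl; rewrite sumrB !sum_delta. Qed.

(** * Edges and vertex elements generate the same left ideal *)

Section VertexElements.
Variables (F : fieldType) (G : layeredGraph) (R : algType F).
Local Notation V := (vertex G).
Local Notation E := (edge G).
Local Notation X := (posVertex G).

Lemma sum_posVertex (W : nmodType) (f : V -> W) :
  (forall w, level w = 0%N -> f w = 0) -> \sum_w f w = \sum_(v : X) f (val v).
Proof.
move=> f0; rewrite (bigID (fun w => (0 < level w)%N)) /= [X in _ + X]big1 => [|w].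
  rewrite addr0 (reindex_omap (val : X -> V) insub) => [|w lw]; last by rewrite insubT.
  by apply: eq_bigl => -[w lw] /=; rewrite insubT /= lw eqxx.
by rewrite lt0n negbK => /eqP/f0.
Qed.

Variables (h : E -> R) (hat : V -> R).
Hypothesis out_edge : forall v : V, (0 < level v)%N -> exists w, adj v w.
Hypothesis hat0 : forall v, level v = 0%N -> hat v = 0.
Hypothesis hatE : forall e, h e = hat (etail e) - hat (ehead e).

Lemma vertex_element_ind (P : V -> Prop) :
    (forall v, level v = 0%N -> P v) ->
    (forall e, hat (etail e) = h e + hat (ehead e) -> P (ehead e) -> P (etail e)) ->
  forall v, P v.
Proof.
move=> P0 PS v; move: {2}(level v) (erefl (level v)) => n.
elim: n v => [|n IHn] v lv; first exact: P0.
have [|w /adjP[e [ev _]]] := @out_edge v; first by rewrite lv.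
move: lv; rewrite -ev level_etail => -[lv].
by apply: PS; [rewrite hatE subrK | apply: IHn].
Qed.

Lemma vertex_element_lin v : exists c : E -> F, hat v = \sum_e c e *: h e.
Proof.
elim/vertex_element_ind: v => [v lv|e he [c cE]].
  by exists (fun=> 0); rewrite hat0 // big1 // => e _; rewrite scale0r.
exists (fun f => (f == e)%:R + c f); rewrite he cE.
under [RHS]eq_bigr do rewrite scalerDl.
rewrite big_split /= [X in _ = X + _](bigD1 e) //= eqxx scale1r [X in _ = _ + X + _]big1 ?addr0 // => f /negPf->.
by rewrite scale0r.
Qed.

Lemma vertex_comb_edge_comb (c : X -> F) :
  exists c' : E -> F, \sum_v c v *: hat (val v) = \sum_e c' e *: h e.
Proof.
have /choice[k kE] := vertex_element_lin.
exists (fun e => \sum_v c v * k (val v) e).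
under [LHS]eq_bigr do rewrite kE scaler_sumr.
rewrite exchange_big; apply: eq_bigr => e _; rewrite scaler_suml.
by apply: eq_bigr => v _; rewrite scalerA.
Qed.

Lemma left_ideal_vertex_elements x :
  (exists y : E -> R, x = \sum_e y e * h e) <->
  (exists y : X -> R, x = \sum_v y v * hat (val v)).
Proof.
split=> [[y ->]|[y ->]].
  (* Summation by parts: [hat v] collects the edges out of [v] minus the edges into [v]. *)
  exists (fun v => \sum_(e | etail e == val v) y e - \sum_(e | ehead e == val v) y e).
  pose z w := \sum_(e | etail e == w) y e - \sum_(e | ehead e == w) y e.
  rewrite -(@sum_posVertex _ (fun w => z w * hat w)) => [|w lw]; last first.
    by rewrite hat0 // mulr0.
  have part (t : E -> V) : \sum_w (\sum_(e | t e == w) y e) * hat w =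
      \sum_e y e * hat (t e).
    under eq_bigr do rewrite mulr_suml big_mkcond.
    rewrite exchange_big; apply: eq_bigr => e _; rewrite (bigD1 (t e)) //= eqxx.
    rewrite [X in _ + X]big1 ?addr0 // => w ne; case: eqP => // te.
    by move: ne; rewrite te eqxx.
  under [RHS]eq_bigr do rewrite mulrBl.
  rewrite sumrB !part -sumrB; apply: eq_bigr => e _.
  by rewrite hatE mulrBr.
have /choice[k kE] := vertex_element_lin.
exists (fun e => \sum_v k (val v) e *: y v).
under [LHS]eq_bigr do rewrite kE mulr_sumr.
rewrite exchange_big; apply: eq_bigr => e _; rewrite mulr_suml.
by apply: eq_bigr => v _; rewrite -scalerAr scalerAl.
Qed.

End VertexElements.

(** * Koszulness of A for the graph *)

Section KoszulA.
Variables (F : fieldType) (G : layeredGraph) (a : vertex G).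
Local Notation V := (vertex G).
Local Notation E := (edge G).
Hypothesis hunif : uniform G.
Hypothesis hlevel : forall v : V, (level v <= 3)%N.
Hypothesis hmin : exists! v : V, minimal v.
Hypothesis hmin0 : forall v : V, minimal v -> v \in layer G 0.
Hypothesis htop : layer G 3 = [set a].
Hypothesis habove : forall b : V, b \in layer G 2 -> above a b.
Local Notation X := (posVertex G).
Local Notation A' := (presAlg (vertex_relations F a)).
Local Notation gv := (pgen (vertex_relations F a)).
Local Notation A := (algA G F).
Local Notation ge := (pgen (A_relations G F)).
Local Notation topv := (topv htop).

Let adjX (u v : X) := adj (val u) (val v).
Let path3 (p : X * X) := adjX topv p.1 && adjX p.1 p.2.

(** A quadratic relation contributes a difference of two rows of [rho], so the coefficients sum to
    zero; the relations at level zero have no derivative at positive levels. *)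
Lemma vertex_syzygy (x : X -> A') : \sum_v x v * gv (val v) = 0 ->
  exists u : X * X -> A', [/\ forall p, ~~ path3 p -> u p = 0, \sum_p u p = 0
    & forall v, x v = \sum_p u p * rho topv (fun w => gv (val w)) p v].
Proof.
move=> x0; pose x' w := if insub w is Some v then x v else 0.
have x'E v : x' (val v) = x v by rewrite /x' valK.
have [|n [y [r [hr xE]]]] := @pres_syzygy F _ (vertex_relations F a) x'.
  rewrite sum_posVertex => [|w lw].
    by rewrite -[RHS]x0; apply: eq_bigr => v _; rewrite x'E.
  by rewrite /x' insubF ?mul0r // lw.
have /choice[u hu] i : exists u : X * X -> A', [/\ forall p, ~~ path3 p -> u p = 0,
    \sum_p u p = 0 & forall v : X, fox (vertex_relations F a) (val v) (r i) =
      \sum_p u p * rho topv (fun w => gv (val w)) p v].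
  case: (hr i) => [[s [ls ->]]|[b [c [b' [c' [[ab bc ab' bc'] ->]]]]]].
    exists (fun=> 0); split=> [//||v]; rewrite big1 // => [|p _]; last by rewrite mul0r.
    rewrite fox_fgen; case: eqP => // sv.
    by have := valP v; rewrite /= -sv ls.
  have pos2 (b1 c1 : V) : adj a b1 -> adj b1 c1 -> exists2 p : X * X,
      path3 p & (val p.1 = b1) /\ (val p.2 = c1).
    move=> ab1 bc1; have lb : level b1 = 2.
      by apply/eqP; rewrite -(adj_top htop habove).
    have lc : level c1 = 1%N by have := adj_level bc1; rewrite lb => -[].
    have pb : (0 < level b1)%N by rewrite lb.
    have pc : (0 < level c1)%N by rewrite lc.
    by exists (Sub b1 pb, Sub c1 pc) => //; apply/andP.
  have [p hp [p1 p2]] := pos2 b c ab bc; have [p' hp' [p1' p2']] := pos2 b' c' ab' bc'.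
  have sum_one (q : X * X) : \sum_p (p == q)%:R = 1 :> A'.
    by rewrite -[RHS](sum_delta q (fun=> 1)); apply: eq_bigr => j _; rewrite mulr1.
  exists (fun q => (q == p)%:R - (q == p')%:R); split=> [q hq||v].
  - case: eqP => [eq|_]; first by move: hq; rewrite eq hp.
    case: eqP => [eq|_]; first by move: hq; rewrite eq hp'.
    by rewrite subrr.
  - by rewrite sumrB !sum_one subrr.
  have foxE (q : X * X) : fox (vertex_relations F a) (val v)
      (quad_rel F a (val q.1) (val q.2)) = rho topv (fun w => gv (val w)) q v.
    by apply: etrans (fox_quad_rel _ _ _ _ _) _; rewrite !val_eqE.
  rewrite -p1 -p2 -p1' -p2'; apply: etrans (foxB _ _ _ _) _.
  apply: etrans (congr2 (fun s t => s - t) (foxE p) (foxE p')) _.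
  exact: (esym (sum_delta_sub p p' _)).
exists (fun p => \sum_i y i * u i p); split=> [p hp||v].
- by rewrite big1 // => i _; have [-> //] := hu i; rewrite mulr0.
- rewrite exchange_big big1 //= => i _.
  by have [_ us _] := hu i; rewrite -mulr_sumr us mulr0.
rewrite -x'E xE; under [RHS]eq_bigr do rewrite mulr_suml.
rewrite exchange_big; apply: eq_bigr => i _; have [_ _ ->] := hu i.
by rewrite mulr_sumr; apply: eq_bigr => p _; rewrite mulrA.
Qed.

Lemma rmorph_rho (R S : algType F) (phi : {rmorphism R -> S}) (h : X -> R) p v :
  phi (rho topv h p v) = rho topv (fun w => phi (h w)) p v.
Proof. by rewrite /rho rmorphD !rmorphM !rmorphB !rmorph_nat. Qed.

Lemma algA_vertex_elements : exists hat : V -> A,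
  [/\ forall v, level v = 0%N -> hat v = 0,
      forall e, ge e = hat (etail e) - hat (ehead e)
    & forall b c b' c' : V, adj a b -> adj b c -> adj a b' -> adj b' c' ->
      (hat a - hat b) * hat b + (hat b - hat c) * hat c
      = (hat a - hat b') * hat b' + (hat b' - hat c') * hat c'].
Proof.
have [s [smin _]] := hmin.
have ls : level s = 0%N by apply/eqP; have := hmin0 smin; rewrite inE.
apply: (vertex_elements_exist (s := s)).
- exact: level_a htop.
- move=> v; apply/eqP/eqP => [lv|->//]; exact: bottom_unique hmin _ _ lv ls.
- exact: out_edge hmin0.
- exact: algA_h_path.
Qed.

Section Elements.
Variable hat : V -> A.
Hypothesis hat0 : forall v, level v = 0%N -> hat v = 0.
Hypothesis hatE : forall e, ge e = hat (etail e) - hat (ehead e).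
Hypothesis hat_quad : forall b c b' c' : V,
  adj a b -> adj b c -> adj a b' -> adj b' c' ->
  (hat a - hat b) * hat b + (hat b - hat c) * hat c
  = (hat a - hat b') * hat b' + (hat b' - hat c') * hat c'.

Lemma vertex_to_algA : exists psi : {rmorphism A' -> A},
  (forall v, psi (gv v) = hat v) /\ (forall c x, psi (c *: x) = in_alg A c * psi x).
Proof.
apply: presAlg_hom; first exact: in_alg_central.
move=> phi phig r [[v [lv ->]]|[b [c [b' [c' [[ab bc ab' bc'] ->]]]]]].
  by rewrite phig hat0.
have quadE u w : phi (quad_rel F a u w) =
    (hat a - hat u) * hat u + (hat u - hat w) * hat w.
  by apply: etrans (rmorph_quad phi _ _ _) _; rewrite !phig.
apply: etrans (rmorphB phi _ _) _; apply/eqP; rewrite subr_eq0; apply/eqP.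
apply: etrans (quadE b c) (etrans _ (esym (quadE b' c'))).
exact: hat_quad.
Qed.

(** [theta] sends [hat v] to the generator [gv v] and has [psi] as left inverse, so a syzygy is
    pushed to [A'], resolved there and pulled back. *)
Lemma algA_syzygy (x : X -> A) : \sum_v x v * hat (val v) = 0 ->
  exists u : X * X -> A, [/\ forall p, ~~ path3 p -> u p = 0, \sum_p u p = 0
    & forall v, x v = \sum_p u p * rho topv (fun w => hat (val w)) p v].
Proof.
move=> x0; have [theta [thetag thetaZ]] := algA_to_vertex F hunif hlevel hmin0 htop habove.
have [psi [psig psiZ]] := vertex_to_algA.
have theta_hat v : theta (hat v) = gv v.
  elim/(vertex_element_ind (out_edge hmin0) hatE): v => [v lv|e he IHe].
    by rewrite hat0 // rmorph0 vertex_gen0.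
  by rewrite he rmorphD thetag IHe subrK.
have psi_theta y : psi (theta y) = y.
  elim/presAlg_ind: y => [|y z hy hz|c y hy|e y hy].
  - by rewrite !rmorph1.
  - by rewrite !rmorphD hy hz.
  - by rewrite thetaZ rmorphM hy /= psiZ rmorph1 mulr1 /= -scalerAl mul1r.
  - by rewrite !rmorphM hy thetag rmorphB !psig -hatE.
have [|u [u0 us xE]] := @vertex_syzygy (fun v => theta (x v)).
  transitivity (theta (\sum_v x v * hat (val v))); last by rewrite x0 rmorph0.
  by rewrite rmorph_sum; apply: eq_bigr => v _; rewrite rmorphM theta_hat.
exists (fun p => psi (u p)); split=> [p /u0->||v]; first exact: rmorph0.
  by rewrite -rmorph_sum us rmorph0.
rewrite -[LHS]psi_theta xE rmorph_sum; apply: eq_bigr => p _.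
rewrite rmorphM; congr (_ * _); rewrite rmorph_rho /rho.
by rewrite !psig.
Qed.

End Elements.

Lemma koszul_algA : koszul (@grA G F).
Proof.
have [hat [hat0 hatE hat_quad]] := algA_vertex_elements.
have out := out_edge hmin0.
have [b tb] : exists b, adjX topv b.
  by apply: (posVertex_edge_below hmin0 habove); rewrite eqxx.
have [c bc] : exists c, adjX b c.
  by apply: (posVertex_edge_below hmin0 (htop := htop) habove); rewrite -/(adjX topv b) tb orbT.
have gr1 (k : X -> F) : @grA G F 1%N (\sum_v k v *: hat (val v)).
  have [c' ->] := vertex_comb_edge_comb out hat0 hatE k.
  by apply/(word_comp1P ge); exists c'.
have aug x : augmentation_ideal (@grA G F) x <->
    exists y : X -> A, x = \sum_v y v * hat (val v).
  apply: iff_trans (augmentation_idealP (@presAlg_ind _ _ (A_relations G F)) x) _.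
  exact: left_ideal_vertex_elements out hat0 hatE x.
have quad (p p' : X * X) : path3 p -> path3 p' ->
    (hat (val topv) - hat (val p.1)) * hat (val p.1)
    + (hat (val p.1) - hat (val p.2)) * hat (val p.2) =
    (hat (val topv) - hat (val p'.1)) * hat (val p'.1)
    + (hat (val p'.1) - hat (val p'.2)) * hat (val p'.2).
  by move=> /andP[h1 h2] /andP[h1' h2']; apply: hat_quad.
apply: (@koszul_edgeAlgebra F X adjX topv (posVertex_no_edge_to_top hlevel htop)
  (@posVertex_edge_to_second G a htop habove) A (@grA G F) (fun v => hat (val v)) gr1 aug quad _ (b, c)).
- move=> x /(algA_syzygy hat0 hatE hat_quad)[u [u0 us xE]].
  by exists u; split=> // v; rewrite xE; apply: sum_rho.
- exact/andP.
Qed.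

End KoszulA.

Theorem mainTheorem4 (F : fieldType) (G : layeredGraph) (a : vertex G)
  (hunif : uniform G)
  (hsimple : simple_edges G)
  (hlevel : forall v : vertex G, (level v <= 3)%N)
  (hmin : exists! v : vertex G, minimal v)
  (hmin0 : forall v : vertex G, minimal v -> v \in layer G 0)
  (htop : layer G 3 = [set a])
  (habove : forall b : vertex G, b \in layer G 2 -> above a b) :
  koszul (@grA G F) /\
  koszul (@grB G F) /\
  ((forall c : vertex G, c \in layer G 1 ->
      exists2 b : vertex G, b \in layer G 2 & above b c) ->
   hilbert_series_eq (@grB G F)
     (1 + #|[set v : vertex G | (0 < level v)%N]|%:Z *: 'X
        + (#|edges_from G 2|%:Z - 1) *: 'X^2
        + (#|edges_from G 2|%:Z - #|layer G 1|%:Z - #|layer G 2|%:Z + 1)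
            *: 'X^3)).
Proof.
split; first exact: (koszul_algA F hunif hlevel hmin hmin0 htop habove).
split; first exact: koszul_algB hlevel htop habove F.
exact: (hilbert_series_algB hunif hlevel hmin0 htop habove hsimple).
Qed.
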